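(* Let \[ \mathbb{P}_3=\det\begin{bmatrix} x_1 & x_1^2 & x_1^4\\ x_2 & x_2^2 & x_2^4\\ x_3 & x_3^2 & x_3^4\end{bmatrix}\in(\mathbb{Z}/2)[x_1,x_2,x_3] \] be the Dickson polynomial in three variables, and let $d\ge 1$ and $k\ge 0$ be integers. If \[ \frac{1}{x_2x_3}\left(\frac{1}{x_1}\mathbb{P}_3\right)^{k+1}\notin (x_1^d,x_2^d,x_3^d), \] where the right-hand side is the ideal of $(\mathbb{Z}/2)[x_1,x_2,x_3]$ generated by $x_1^d,x_2^d,x_3^d$, then every mass distribution $\mu$ in $\mathbb{R}^d$ admits an equipartition by a collection of $2k+1$ parallel hyperplanes and two additional non-parallel hyperplanes in $(2k+2)\times 2\times 2$ boxes; that is, such hyperplanes exist for which each of the $4(2k+2)$ boxes has $\mu$-measure $\frac{1}{4(2k+2)}\mu(\mathbb{R}^d)$.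
   Context: A mass distribution in $\mathbb{R}^d$ is a finite Borel measure $\mu$ of the form $\mu(A)=\int_A f\,dx$ for an integrable density function $f:\mathbb{R}^d\to\mathbb{R}$ (integration with respect to Lebesgue measure), such that every nonempty open subset of $\mathbb{R}^d$ has positive $\mu$-measure. The two additional hyperplanes being non-parallel means that neither is parallel to the hyperplanes of the parallel collection and that they are not parallel to each other. Boxes: a collection of $l$ parallel hyperplanes divides $\mathbb{R}^d$ into $l+1$ consecutive regions, and each additional hyperplane divides $\mathbb{R}^d$ into two half-spaces; the $(l+1)\times 2\times 2$ boxes are the intersections of one of the $l+1$ regions with one half-space of each of the two additional hyperplanes. A single hyperplane counts as a collection of one parallel hyperplane. The polynomial $\mathbb{P}_3$ is divisible by $x_1x_2x_3$, so the expression $\frac{1}{x_2x_3}\left(\frac{1}{x_1}\mathbb{P}_3\right)^{k+1}$ denotes a polynomial. *)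

(* Defs.v *)
From HB Require Import structures.
From mathcomp Require Import all_boot all_order all_algebra.
(* The notations of multinomials clash with those of MathComp-Analysis. *)
From mathcomp Require Import -(notations) mpoly.
From mathcomp Require Import lra.
From mathcomp Require Import all_classical all_reals all_analysis.

Set Implicit Arguments.
Unset Strict Implicit.
Unset Printing Implicit Defensive.

Import Order.TTheory GRing.Theory Num.Theory.
Import numFieldNormedType.Exports.

Local Open Scope classical_set_scope.
Local Open Scope ring_scope.

Notation F2poly3 := (mpoly 3 'F_2).

(* The variables x_1, x_2, x_3 are numbered 0, 1, 2. *)
Definition xvar (i : 'I_3) : F2poly3 := mpolyX 'F_2 (mnm1 i).

Definition dickson3 : F2poly3 := \det (\matrix_(i < 3, j < 3) xvar i ^+ (2 ^ j)).

(* [p] lies in the ideal generated by the elements of [s]. *)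
Definition in_ideal_of (A : comNzRingType) (s : seq A) (p : A) : Prop :=
  exists c : 'I_(size s) -> A, p = \sum_i c i * s`_i.

(* [Q] is the polynomial equal, in the field of rational functions, to
   1 / (x_2 x_3) * (1 / x_1 * P_3) ^ (k + 1). *)
Definition obstruction_poly (k : nat) (Q : F2poly3) : Prop :=
  tofrac Q = (tofrac (xvar 1 * xvar 2))^-1
             * ((tofrac (xvar 0))^-1 * tofrac dickson3) ^+ k.+1.

Lemma dickson3E : dickson3 = xvar 0 * xvar 1 * xvar 2
  * \det (\matrix_(i < 3, j < 3) xvar i ^+ (2 ^ j).-1).
Proof.
pose D : 'rV[F2poly3]_3 := \row_i xvar i.
pose V := \matrix_(i < 3, j < 3) xvar i ^+ (2 ^ j).-1.
rewrite /dickson3 (_ : \matrix_(i, j) _ = diag_mx D *m V); last first.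
  apply/matrixP => i j; rewrite mul_diag_mx !mxE -exprS prednK//.
  by rewrite expn_gt0.
rewrite det_mulmx det_diag !big_ord_recl big_ord0 !mxE mulr1 mulrA.
by congr (xvar _ * xvar _ * xvar _ * _); exact: val_inj.
Qed.

Lemma quotient_expE (F : fieldType) (a b c v : F) (k : nat) :
  a != 0 -> b != 0 -> c != 0 ->
  (b * c) ^+ k * v ^+ k.+1 = (b * c)^-1 * (a^-1 * (a * b * c * v)) ^+ k.+1.
Proof.
move=> a0 b0 c0; have bc0 : b * c != 0 by exact: mulf_neq0.
rewrite -!(mulrA a) mulKf//; move: (b * c) bc0 => e e0.
by rewrite exprMn (exprS e) !mulrA mulVf ?mul1r.
Qed.

Lemma tofrac_xvar_neq0 i : tofrac (xvar i) != 0.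
Proof.
rewrite tofrac_eq0; apply/negP => /eqP /mpolyP /(_ (mnm1 i)).
by rewrite mcoeffX mcoeff0 eqxx => /eqP; rewrite oner_eq0.
Qed.

Lemma obstruction_poly_exists k : exists Q, obstruction_poly k Q.
Proof.
pose V := \det (\matrix_(i < 3, j < 3) xvar i ^+ (2 ^ j).-1).
exists ((xvar 1 * xvar 2) ^+ k * V ^+ k.+1).
rewrite /obstruction_poly dickson3E -/V !tofracM !tofracXn !tofracM.
apply: quotient_expE; exact: tofrac_xvar_neq0.
Qed.

(* R^d with its Borel sigma-algebra. *)
Definition borelRV (R : realType) (d : nat) :=
  g_sigma_algebraType (@open 'rV[R]_d).

(* Lebesgue measure on R^d, by Tonelli's formula: the measure of A is the
   integral over x of the (d-1)-dimensional measures of the sections of A at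
   first coordinate x. *)
Fixpoint lebesgueRV (R : realType) (d : nat) : set (borelRV R d) -> \bar R :=
  match d with
  | 0 => fun A => \d_(0 : borelRV R 0) A
  | d'.+1 => fun A => (\int[lebesgue_measure]_(x in [set: R])
      lebesgueRV [set v : 'rV[R]_d' |
                   A (row_mx (const_mx x : 'rV[R]_1) v : 'rV[R]_(1 + d'))])%E
  end.

Definition boxRV (R : realType) (d : nat) (a b : 'rV[R]_d) : set 'rV[R]_d :=
  [set v | forall i, a 0 i <= v 0 i <= b 0 i].

Section sigma_finite_measure_of.
Context (dT : measure_display) (T : measurableType dT) (R : realType).
Variable m : {measure set T -> \bar R}.
Hypothesis m_sigma_finite : sigma_finite [set: T] m.

Let m' : set T -> \bar R := m.
HB.instance Definition _ := Measure.on m'.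
HB.instance Definition _ :=
  Measure_isSigmaFinite.Build _ _ _ m' m_sigma_finite.

Lemma sigma_finite_measure_of :
  exists s : {sigma_finite_measure set T -> \bar R}, forall A, m A = s A.
Proof. by exists m'. Qed.

End sigma_finite_measure_of.

Section lebesgueRV_measure.
Variable R : realType.

Lemma measurable_coordRV (d : nat) (i : 'I_d) :
  measurable_fun [set: borelRV R d] (fun v => v 0 i : R).
Proof.
apply: (measurability _ (measurable_realfun.RGenOpens.measurableE R)).
move=> _ [_ [a [b ->]] <-]; rewrite setTI; apply: sub_sigma_algebra => /=.
apply: (@open_comp _ _ (fun v : 'rV[R]_d => v 0 i)); last exact: interval_open.
by move=> v _; exact: coord_continuous.
Qed.

Lemma measurable_boxRV (d : nat) (a b : 'rV[R]_d) :
  measurable (boxRV a b : set (borelRV R d)).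
Proof.
rewrite (_ : boxRV a b =
    \bigcap_(i in [set: 'I_d]) ((fun v => v 0 i) @^-1` `[a 0 i, b 0 i])).
  apply: fin_bigcap_measurable => // i _.
  rewrite -[X in measurable X]setTI.
  by apply: measurable_coordRV => //; exact: measurable_itv.
apply/seteqP; split => [v h i _|v h i] /=; first by rewrite in_itv/=; exact: h.
by have := h i I; rewrite /= in_itv.
Qed.

Lemma measurable_fun_borelRV (dT : measure_display) (T : measurableType dT)
    (d : nat) (f : T -> borelRV R d) :
  (forall i, measurable_fun [set: T] (fun t => f t 0 i : R)) ->
  measurable_fun [set: T] f.
Proof.
move=> mf; have mE : @measurable _ (borelRV R d) = <<s @open 'rV[R]_d >> by [].
apply: (measurability _ mE) => _ [U oU <-].
pose lo (p : 'rV[rat]_d * nat) : 'rV[R]_d :=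
  \row_i (ratr (p.1 0 i) - p.2.+1%:R^-1).
pose hi (p : 'rV[rat]_d * nat) : 'rV[R]_d :=
  \row_i (ratr (p.1 0 i) + p.2.+1%:R^-1).
rewrite setTI (_ : f @^-1` U = \bigcup_p
    (if `[< boxRV (lo p) (hi p) `<=` U >]
     then f @^-1` boxRV (lo p) (hi p) else set0)); last first.
  apply/seteqP; split => [t Uft|t [p _]]; last by case: asboolP => // + h; exact.
  have /nbhs_ballP[e /= e0 eU] : nbhs (f t : 'rV[R]_d) U by exact: open_nbhs_nbhs.
  have aux (y r w z : R) : w < e / 2 -> y - w < r -> r < y + w ->
      r - w <= z -> z <= r + w -> z - e < y < z + e.
    by move=> *; apply/andP; split; lra.
  have [n ne] : exists n : nat, n.+1%:R^-1 < e / 2.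
    exists (Num.trunc (e / 2)^-1); rewrite invf_plt ?posrE ?divr_gt0//.
    exact: truncnS_gt.
  have qP i : exists q : rat, f t 0 i - n.+1%:R^-1 < ratr q < f t 0 i + n.+1%:R^-1.
    have [|q] := @rat_in_itvoo R (f t 0 i - n.+1%:R^-1) (f t 0 i + n.+1%:R^-1).
      by rewrite ltrD2l gtrN// invr_gt0.
    by rewrite in_itv => ?; exists q.
  have [q {}qP] := choice qP.
  exists (\row_i q i, n) => //.
  have inb : boxRV (lo (\row_i q i, n)) (hi (\row_i q i, n)) (f t).
    move=> i; rewrite !mxE /=; have /andP[h1 h2] := qP i.
    by rewrite lerBlDr ltW//= -lerBlDr ltW.
  case: asboolP => // -[]; move=> v vb; apply: eU; split => // i j.
  rewrite !ord1; have := vb j; rewrite !mxE /= => /andP[v1 v2].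
  have /andP[h1 h2] := qP j; rewrite /ball/= ltr_distl; exact: (aux _ (ratr (q j)) n.+1%:R^-1).
apply: countable_bigcupT_measurable => [|p]; first exact: countableP.
case: ifP => // _.
rewrite (_ : _ @^-1` _ = \bigcap_(i in [set: 'I_d])
    ((fun t => f t 0 i) @^-1` `[lo p 0 i, hi p 0 i])).
  apply: fin_bigcap_measurable => // i _.
  by rewrite -[X in measurable X]setTI; apply: mf => //; exact: measurable_itv.
apply/seteqP; split => [v h i _|v h i] /=; first by rewrite in_itv/=; exact: h.
by have := h i I; rewrite /= in_itv.
Qed.

Let consRV (d : nat) (p : R * borelRV R d) : borelRV R d.+1 :=
  row_mx (const_mx p.1 : 'rV[R]_1) (p.2 : 'rV[R]_d).

Let measurable_consRV (d : nat) : measurable_fun setT (@consRV d).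
Proof.
apply: measurable_fun_borelRV => i.
case: (@split_ordP 1 d i) => j ->.
  rewrite (_ : (fun _ => _) = fst); first exact: measurable_fst.
  by apply/funext => p; rewrite [LHS]row_mxEl mxE.
rewrite (_ : (fun _ => _) = (fun v : borelRV R d => v 0 j) \o snd).
  exact: (measurableT_comp (measurable_coordRV j) measurable_snd).
by apply/funext => p; rewrite [LHS]row_mxEr.
Qed.

Let lebesgueRV_spec (d : nat) :
  (exists m : {sigma_finite_measure set (borelRV R d) -> \bar R},
    forall A, lebesgueRV A = m A) /\
  (forall a b : 'rV[R]_d, (forall i, a 0 i <= b 0 i) ->
    lebesgueRV (boxRV a b : set (borelRV R d)) = (\prod_i (b 0 i - a 0 i))%:E).
Proof.
elim: d => [|d [[m mE] mbox]].
  split; first by exists \d_(0 : borelRV R 0).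
  by move=> a b _; rewrite big_ord0 /= diracE mem_set// => -[].
pose mp := (@lebesgue_measure R \x m)%E.
pose M0 : {measure set (borelRV R d.+1) -> \bar R} :=
  measure_function_pushforward__canonical__measure_function_Measure
    mp (@measurable_consRV d).
have ME A : lebesgueRV A = M0 A.
  apply: eq_integral => x _; apply: (etrans (mE _)); rewrite /=; congr (m _).
  by apply/seteqP; split => v; rewrite /xsection /= in_setE.
have boxE (a b : 'rV[R]_(1 + d)) : (forall i, a 0 i <= b 0 i) ->
    M0 (boxRV a b : set (borelRV R d.+1)) = (\prod_i (b 0 i - a 0 i))%:E.
  move=> ab; rewrite /M0 /= /pushforward.
  rewrite (_ : _ @^-1` _ = `[a 0 (lshift d 0), b 0 (lshift d 0)] `*`
      (boxRV (rsubmx a) (rsubmx b))); last first.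
    apply/seteqP; split => [[x v] /= h|[x v] /= [h1 h2] i].
      rewrite in_itv /=; split.
        by have := h (lshift d 0); rewrite row_mxEl mxE.
      by move=> i; have := h (rshift 1 i); rewrite row_mxEr !mxE.
    case: (@split_ordP 1 d i) => j ->.
      by rewrite row_mxEl mxE ord1; move: h1; rewrite in_itv.
    by rewrite row_mxEr; have := h2 j; rewrite !mxE.
  rewrite product_measure1E//; last exact: measurable_boxRV.
  rewrite -mE mbox; last by move=> i; rewrite !mxE.
  rewrite /= lebesgue_measure_itv /= lte_fin (@big_split_ord _ _ _ 1 d) big_ord1 /=.
  rewrite [in RHS]EFinM; congr (_ * _)%E.
    case: ltP => [//|ba]; congr EFin.
    by apply/esym/eqP; rewrite subr_eq0 eq_le ba ab.
  by congr EFin; apply: eq_bigr => i _; rewrite !mxE.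
split; last by move=> a b ab; rewrite ME boxE.
have sf : sigma_finite [set: borelRV R d.+1] M0.
  exists (fun n => boxRV (const_mx (- n%:R)) (const_mx n%:R)).
    apply/esym; rewrite -subTset => v _.
    exists (Num.trunc (\sum_i `|v 0 i|)).+1 => // i; rewrite !mxE -ler_norml.
    apply: (le_trans _ (ltW (truncnS_gt _))).
    by rewrite (bigD1 i)//= lerDl sumr_ge0.
  move=> n; split; first exact: measurable_boxRV.
  by rewrite boxE ?ltry// => i; rewrite !mxE; apply: (@le_trans _ _ 0); rewrite ?oppr_le0 ler0n.
have [M MP] := sigma_finite_measure_of sf.
by exists M => A; rewrite ME.
Qed.

Lemma lebesgueRV_box (d : nat) (a b : 'rV[R]_d) : (forall i, a 0 i <= b 0 i) ->
  lebesgueRV (boxRV a b : set (borelRV R d)) = (\prod_i (b 0 i - a 0 i))%:E.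
Proof. by case: (lebesgueRV_spec d) => _; exact. Qed.

Let lebesgueRV0 (d : nat) : @lebesgueRV R d set0 = 0%E.
Proof. by case: (lebesgueRV_spec d) => -[m mE] _; rewrite mE measure0. Qed.

Let lebesgueRV_ge0 (d : nat) A : (0 <= @lebesgueRV R d A)%E.
Proof. by case: (lebesgueRV_spec d) => -[m mE] _; rewrite mE. Qed.

Let lebesgueRV_sigma_additive (d : nat) : semi_sigma_additive (@lebesgueRV R d).
Proof.
case: (lebesgueRV_spec d) => -[m mE] _; rewrite (_ : @lebesgueRV R d = m).
  exact: measure_semi_sigma_additive.
exact/funext.
Qed.

HB.instance Definition _ (d : nat) := isMeasure.Build _ _ _ (@lebesgueRV R d)
  (lebesgueRV0 d) (@lebesgueRV_ge0 d) (@lebesgueRV_sigma_additive d).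

Let lebesgueRV_sigma_finite (d : nat) : sigma_finite setT (@lebesgueRV R d).
Proof.
case: (lebesgueRV_spec d) => -[m mE] _; rewrite (_ : @lebesgueRV R d = m).
  exact: sigma_finiteT.
exact/funext.
Qed.

HB.instance Definition _ (d : nat) := Measure_isSigmaFinite.Build _ _ _
  (@lebesgueRV R d) (@lebesgueRV_sigma_finite d).

End lebesgueRV_measure.

Definition mass_distribution (R : realType) (d : nat)
    (mu : {finite_measure set (borelRV R d) -> \bar R}) : Prop :=
  (exists f : borelRV R d -> R,
     (@lebesgueRV R d).-integrable [set: borelRV R d] (EFin \o f) /\
     forall A : set (borelRV R d), measurable A ->
       mu A = (\int[@lebesgueRV R d]_(x in A) (f x)%:E)%E) /\
  (forall U : set 'rV[R]_d, open U -> U !=set0 -> (0 < mu U)%E).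

Definition dotRV (R : realType) (d : nat) (u x : 'rV[R]_d) : R :=
  \sum_i u 0 i * x 0 i.

(* The hyperplane [dotRV u x = c], for a nonzero normal vector [u], is given by
   the pair [u], [c]. Two hyperplanes with nonzero normals [u], [v] are parallel
   iff [parallel_normals u v]. *)
Definition parallel_normals (R : realType) (d : nat) (u v : 'rV[R]_d) : Prop :=
  exists t : R, v = t *: u.

Definition halfspace (R : realType) (d : nat) (s : bool) (u : 'rV[R]_d) (c : R) :
    set 'rV[R]_d :=
  [set x | if s then c <= dotRV u x else dotRV u x <= c].

(* For c_0 < ... < c_(l-1), the j-th of the l + 1 closed regions cut out by the
   parallel hyperplanes [dotRV u x = c_i], i.e. c_(j-1) <= dotRV u x <= c_j
   where a bound whose index is out of range is dropped. *)
Definition region (R : realType) (d l : nat) (u : 'rV[R]_d) (c : 'I_l -> R)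
    (j : 'I_l.+1) : set 'rV[R]_d :=
  [set x | forall i : 'I_l, if (i < j)%N then c i <= dotRV u x
                            else dotRV u x <= c i].

(* All the (l + 1) x 2 x 2 boxes have the same share of the total mass. The boxes
   are closed; the bounding hyperplanes are null sets for a mass distribution. *)
Definition equipartition (R : realType) (d l : nat)
    (mu : set (borelRV R d) -> \bar R) (u : 'rV[R]_d) (c : 'I_l -> R)
    (v : 'rV[R]_d) (b : R) (w : 'rV[R]_d) (e : R) : Prop :=
  forall (j : 'I_l.+1) (s t : bool),
    mu (region u c j `&` halfspace s v b `&` halfspace t w e)
    = (((4 * l.+1)%:R^-1)%:E * mu [set: borelRV R d])%E.

(* Main.v *)
Require Import Defs.
From mathcomp Require Import all_boot all_order all_algebra.
From mathcomp Require Import -(notations) mpoly.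
From mathcomp Require Import ring lra zify.
From mathcomp Require Import all_classical all_reals all_analysis.
From mathcomp Require Import measurable_realfun.

Set Implicit Arguments.
Unset Strict Implicit.
Unset Printing Implicit Defensive.

Import Order.TTheory GRing.Theory Num.Theory.
Import numFieldNormedType.Exports.

Local Open Scope classical_set_scope.
Local Open Scope ring_scope.

(* A point of (S^(d-1))^3, the rows u, v, w of a 3 x d matrix, determines the
   equipartition of the mass by 2k+1 hyperplanes with normal u and the halving
   hyperplanes with normals v and w. The remaining conditions are the vanishing
   of real functions that change sign under u -> -u, v -> -v, w -> -w according to
   a linear form a x_1 + b x_2 + c x_3 over Z/2, and the product of these linear
   forms is the polynomial of the theorem. A monomial x^m with m_j < d in it
   forces a common zero. Indeed, let s_i be a sign of the i-th function. The
   product of the cocycles s_i(y) - s_i(x) is defined on tuples of points; it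
   vanishes on tuples of small diameter if there is no common zero, because some
   function then has constant sign on the tuple. On the other hand there are sums
   C_m of arbitrarily small tuples (a product of hemispheres of dimensions m_j)
   with boundary the sum over j of C_(m - e_j) and its image under the antipodal
   map of the j-th factor. By Stokes, the value of the product on C_m satisfies
   the recursion of the coefficient of x^m in the product of linear forms. *)

(** * Chains modulo 2 *)

Section Chains.
Variable X : Type.
Implicit Types (t : seq X) (C D : seq (seq X)) (phi : seq X -> 'F_2).

Lemma addF2 (a : 'F_2) : a + a = 0.
Proof. by rewrite addrr_pchar2// pchar_Fp. Qed.

Lemma subF2 (a : 'F_2) : - a = a.
Proof. by apply/esym/eqP; rewrite -addr_eq0 addF2. Qed.

(* A list of tuples stands for their formal sum modulo 2. *)
Definition ev phi C : 'F_2 := \sum_(t <- C) phi t.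

Definition lin (op : seq X -> seq (seq X)) C := flatten (map op C).

Lemma ev_lin phi op C : ev phi (lin op C) = ev (fun t => ev phi (op t)) C.
Proof. by rewrite /ev big_flatten big_map. Qed.

Lemma ev_cat phi C D : ev phi (C ++ D) = ev phi C + ev phi D.
Proof. exact: big_cat. Qed.

Lemma ev_map phi (g : seq X -> seq X) C : ev phi (map g C) = ev (phi \o g) C.
Proof. exact: big_map. Qed.

Lemma ev_cons phi t C : ev phi (t :: C) = phi t + ev phi C.
Proof. exact: big_cons. Qed.

Lemma ev_nil phi : ev phi [::] = 0.
Proof. exact: big_nil. Qed.

Lemma ev_addf phi psi C : ev (fun t => phi t + psi t) C = ev phi C + ev psi C.
Proof. exact: big_split. Qed.

Lemma ev0 C : ev (fun=> 0) C = 0.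
Proof. exact: big1. Qed.

Lemma eq_ev phi psi C : phi =1 psi -> ev phi C = ev psi C.
Proof. by move=> e; apply: eq_bigr. Qed.

Lemma ev_mull (a : 'F_2) phi C : ev (fun t => a * phi t) C = a * ev phi C.
Proof. by rewrite /ev big_distrr. Qed.

(** The augmented simplicial boundary: the boundary of a one-point tuple is the empty tuple, not
    zero. *)
Fixpoint bd t : seq (seq X) :=
  if t is x :: t' then t' :: map (cons x) (bd t') else [::].

(** The prism operator: the sum over i of the tuples (f x_0, ..., f x_i, g x_i, ..., g x_n). *)
Fixpoint prism (f g : X -> X) t : seq (seq X) :=
  if t is x :: t' then
    (f x :: map g t) :: map (cons (f x)) (prism f g t')
  else [::].

Lemma ev_bd_cons phi x t :
  ev phi (bd (x :: t)) = phi t + ev (phi \o cons x) (bd t).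
Proof. by rewrite /= ev_cons ev_map. Qed.

Lemma bd_map phi (g : X -> X) t : ev phi (bd (map g t)) = ev phi (map (map g) (bd t)).
Proof.
elim: t phi => [|x t IH] phi; first by rewrite /= !ev_nil.
rewrite /= !ev_cons !ev_map; congr (_ + _).
by rewrite (IH (phi \o cons (g x))) ev_map.
Qed.

(** The prism operator is a chain homotopy between the maps induced by [f] and [g]. Induction on the
    tuple, splitting off its first vertex; all mixed terms occur twice. *)
Lemma prismP phi f g t :
  ev phi (lin bd (prism f g t)) + ev phi (lin (prism f g) (bd t)) =
  phi (map f t) + phi (map g t).
Proof.
elim: t phi => [|x t IH] phi; first by rewrite /lin /= !ev_nil !addF2.
pose psi := phi \o cons (f x).
have bdE s : ev phi (bd (f x :: s)) = phi s + ev psi (bd s).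
  by rewrite /= ev_cons ev_map.
have prE s : ev phi (prism f g (x :: s)) =
    phi (f x :: g x :: map g s) + ev psi (prism f g s).
  by rewrite /= ev_cons ev_map.
have -> : ev phi (lin bd (prism f g (x :: t))) =
    phi (map g (x :: t)) + ev psi (bd (map g (x :: t)))
    + (ev phi (prism f g t) + ev psi (lin bd (prism f g t))).
  rewrite !ev_lin /= ev_cons ev_map bdE; congr (_ + _).
  by rewrite -ev_addf; apply: eq_ev => s /=; rewrite -bdE.
have -> : ev phi (lin (prism f g) (bd (x :: t))) = ev phi (prism f g t) +
    (ev (psi \o cons (g x)) (bd (map g t)) + ev psi (lin (prism f g) (bd t))).
  rewrite !ev_lin /= ev_cons ev_map bd_map ev_map -ev_addf; congr (_ + _).
  by apply: eq_ev => s /=; rewrite -prE.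
have -> : ev psi (bd (map g (x :: t))) =
    psi (map g t) + ev (psi \o cons (g x)) (bd (map g t)).
  by rewrite /= ev_cons ev_map.
have {IH} := IH psi; set B := ev psi (lin bd _); set P := ev psi (lin _ _).
move=> IH; have -> : P = psi (map f t) + psi (map g t) + B.
  by rewrite -IH addrAC addF2 add0r.
rewrite /psi /=; set a := phi _; set c := phi (f x :: map g t).
set E := ev _ (bd _); set D := ev phi _; set e := phi (f x :: map f t).
transitivity (e + a + (c + c) + (E + E) + (B + B) + (D + D)); first by ring.
by rewrite !addF2 !addr0.
Qed.

(** A homotopy is cut into [n] steps so that the tuples of each prism stay small; the end terms
    telescope in [prismsP]. *)
Definition prisms (h : nat -> X -> X) n t : seq (seq X) :=
  flatten [seq prism (h k) (h k.+1) t | k <- iota 0 n].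

Lemma ev_prisms phi h n t :
  ev phi (prisms h n t) = \sum_(k < n) ev phi (prism (h k) (h k.+1) t).
Proof.
by rewrite /ev big_flatten /= big_map 
  -(big_mkord xpredT (fun k => ev phi (prism (h k) (h k.+1) t))) /index_iota subn0.
Qed.

Lemma prismsP phi h n t :
  ev phi (lin bd (prisms h n t)) + ev phi (lin (prisms h n) (bd t)) =
  phi (map (h 0%N) t) + phi (map (h n) t).
Proof.
rewrite !ev_lin ev_prisms [X in _ + X](eq_ev _ (ev_prisms phi h n)).
rewrite [X in _ + X]/ev exchange_big /= -big_split /=.
transitivity (\sum_(k < n) (phi (map (h k) t) + phi (map (h k.+1) t))).
  by apply: eq_bigr => k _; rewrite -prismP !ev_lin.
elim: n => [|n IH]; first by rewrite big_ord0 addF2.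
by rewrite big_ord_recr /= IH -addrA [X in _ + X]addrA addF2 add0r.
Qed.

Lemma bd_bd phi t : ev phi (lin bd (bd t)) = 0.
Proof.
elim: t phi => [|x t IH] phi; first exact: ev_nil.
rewrite ev_lin /= ev_cons ev_map -ev_addf.
rewrite -[RHS](IH (phi \o cons x)) ev_lin; apply: eq_ev => s /=.
by rewrite ev_cons ev_map addrA addF2 add0r.
Qed.

(** * Hemispheres as iterated suspensions *)

Section Suspension.
Variables (h : nat -> X -> X) (n : nat) (s : X -> X).

Definition sym C := C ++ map (map s) C.

(* If [C] is a hemisphere, then [sym C] is a sphere, and its suspension to the end
   point of the homotopy [h] is the next hemisphere. *)
Definition suspend C := lin (prisms h n) (sym C).

(** The transpose of [suspend], acting on cochains. *)
Definition suspend_dual phi t :=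
  ev phi (prisms h n t) + ev phi (prisms h n (map s t)).

Lemma ev_sym phi C : ev phi (sym C) = ev (fun t => phi t + phi (map s t)) C.
Proof. by rewrite ev_cat ev_map ev_addf. Qed.

Lemma ev_suspend phi C : ev phi (suspend C) = ev (suspend_dual phi) C.
Proof. by rewrite ev_lin ev_sym. Qed.

Hypothesis h0 : h 0%N =1 id.
Hypothesis hn : forall x, h n (s x) = h n x.
Hypothesis sK : involutive s.

(** The transpose takes the same value on a tuple and on its reflection, because [s] is an
    involution, so these values cancel in pairs. *)
Lemma suspend_dualK phi C : ev (suspend_dual phi) (sym C) = 0.
Proof.
rewrite ev_sym -[RHS](ev0 C); apply: eq_ev => t.
by rewrite /suspend_dual mapK// [X in _ + X]addrC addF2.
Qed.

(* The end maps of the homotopy on [C] and on its reflection agree, so that they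
   cancel modulo 2. *)
Lemma bd_suspend phi C :
  ev phi (lin bd (suspend C)) = ev phi (suspend (lin bd C)) + ev phi (sym C).
Proof.
have E D : ev (fun t => ev phi (lin bd (prisms h n t))) D =
    ev (fun t => ev phi (lin (prisms h n) (bd t))) D +
    (ev phi D + ev (phi \o map (h n)) D).
  rewrite -!ev_addf; apply: eq_ev => t /=.
  have := prismsP phi h n t; rewrite (eq_map h0) map_id => <-.
  by rewrite [X in _ = _ + X]addrC addrA addF2 add0r.
transitivity (ev (fun t => ev phi (lin bd (prisms h n t))) (sym C)).
  by rewrite !ev_lin; apply: eq_ev => t; rewrite ev_lin.
rewrite E; congr (_ + _).
  rewrite ev_suspend ev_sym ev_lin; apply: eq_ev => t.
  rewrite !ev_lin /suspend_dual ev_addf; congr (_ + _).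
  by rewrite bd_map ev_map.
rewrite -[RHS]addr0; congr (_ + _).
rewrite ev_sym -[RHS](ev0 C); apply: eq_ev => t /=.
by rewrite -map_comp (eq_map (g := h n)) ?addF2// => x /=.
Qed.

End Suspension.

Section Iteration.
Variables (h : nat -> nat -> X -> X) (n : nat) (s : X -> X).

Fixpoint suspends b C :=
  if b is b'.+1 then suspend (h b) n s (suspends b' C) else C.

Fixpoint suspends_dual b phi :=
  if b is b'.+1 then suspends_dual b' (suspend_dual (h b) n s phi) else phi.

Lemma ev_suspends b phi C : ev phi (suspends b C) = ev (suspends_dual b phi) C.
Proof. by elim: b phi => [|b IH] phi //=; rewrite ev_suspend IH. Qed.

Lemma suspends_dual_nil b phi : phi [::] = 0 -> suspends_dual b phi [::] = 0.
Proof. by elim: b phi => //= b IH phi _; rewrite IH// /suspend_dual addF2. Qed.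

Hypothesis h0 : forall b, h b 0%N =1 id.
Hypothesis hn : forall b x, h b n (s x) = h b n x.
Hypothesis sK : involutive s.

(** Only the last suspension contributes a sphere: the spheres from earlier steps are symmetric, and
    their suspension vanishes by [suspend_dualK]. *)
Lemma bd_suspends b phi C :
  ev phi (lin bd (suspends b C)) = ev phi (suspends b (lin bd C)) +
    (if b is b'.+1 then ev phi (sym s (suspends b' C)) else 0).
Proof.
elim: b phi => [|b IH] phi /=; first by rewrite addr0.
rewrite bd_suspend//; congr (_ + _).
rewrite !ev_suspend IH; case: b {IH} => [|b]; rewrite ?addr0//.
by rewrite suspend_dualK// addr0.
Qed.

(** A symmetry of another factor commutes with the homotopies and with [s], hence with every prism;
    the two chains agree up to the order of their terms. *)
Lemma suspends_sym (s' : X -> X) b phi C :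
  (forall b k x, h b k (s' x) = s' (h b k x)) -> (forall x, s (s' x) = s' (s x)) ->
  ev phi (suspends b (sym s' C)) = ev phi (sym s' (suspends b C)).
Proof.
move=> hs' ss'.
have pr f g t : (forall x, f (s' x) = s' (f x)) -> (forall x, g (s' x) = s' (g x)) ->
    prism f g (map s' t) = map (map s') (prism f g t).
  move=> fs gs; elim: t => //= x t ->; congr cons.
    by rewrite fs gs -!map_comp (eq_map (g := s' \o g)).
  by rewrite -!map_comp; apply: eq_map => r /=; rewrite fs.
have sus h' D : (forall k x, h' k (s' x) = s' (h' k x)) ->
    suspend h' n s (map (map s') D) = map (map s') (suspend h' n s D).
  move=> h's.
  have -> : suspend h' n s (map (map s') D) = lin (prisms h' n) (map (map s') (sym s D)).
    rewrite /suspend /sym map_cat -!map_comp; congr (lin _ (_ ++ _)).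
    by apply: eq_map => t /=; rewrite -!map_comp; apply: eq_map => x /=.
  rewrite /suspend /lin map_flatten -!map_comp; congr flatten; apply: eq_map => t /=.
  rewrite /prisms map_flatten -map_comp; congr flatten; apply: eq_map => k /=.
  exact: pr.
have suss D : suspends b (map (map s') D) = map (map s') (suspends b D).
  by elim: b => //= b ->; apply: sus => k x; exact: hs'.
rewrite ev_cat !ev_suspends ev_cat -!ev_suspends; congr (_ + _).
by rewrite -suss.
Qed.

End Iteration.

(** * Cup products of coboundaries of 0-cochains *)

Section CupProduct.
Variables (I : Type) (sg : I -> X -> 'F_2).

Fixpoint cup (L : seq I) t : 'F_2 :=
  match L, t with
  | [::], [:: _] => 1
  | l :: L', x :: (y :: _) as t' => (sg l x + sg l y) * cup L' t'
  | _, _ => 0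
  end.

(** The cup product of the 0-cochain [sg l] with [cup L]; it serves as a primitive of
    [cup (l :: L)]. *)
Definition scup l L t : 'F_2 := if t is x :: _ then sg l x * cup L t else 0.

Lemma cup_nil_bd t : ev (cup [::]) (bd t) = 0.
Proof.
case: t => [|x [|y [|z t]]] /=; rewrite ?ev_cons ?ev_nil ?addr0 ?addF2//= !ev_map /=.
by rewrite -[RHS](ev0 (bd t)) !add0r.
Qed.

(** The Leibniz rule: as [cup L] is a cocycle, only the differential of [sg l] remains. *)
Lemma cup_scup l L t :
  (forall t, ev (cup L) (bd t) = 0) -> cup (l :: L) t = ev (scup l L) (bd t).
Proof.
move=> cL; case: t => [|x [|y t]]; first by rewrite ev_nil.
  by rewrite ev_cons ev_nil addr0.
have := cL [:: x, y & t]; rewrite (ev_bd_cons _ x) => /eqP.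
rewrite addr_eq0 subF2 => /eqP e.
rewrite (ev_bd_cons _ x) [X in _ + X](_ : _ = sg l x * cup L (y :: t)).
  by rewrite /= mulrDl addrC.
by rewrite e -ev_mull; apply: eq_ev.
Qed.

Lemma cup_bd L t : ev (cup L) (bd t) = 0.
Proof.
elim: L t => [|l L IH] t; first exact: cup_nil_bd.
by rewrite (eq_ev _ (fun t => cup_scup l t IH)) -ev_lin bd_bd.
Qed.

End CupProduct.

End Chains.

Section PrismMembers.
Variable X : eqType.

Lemma prism_mem (f g : X -> X) t r : r \in prism f g t ->
  size r = (size t).+1 /\ {in r, forall x, exists2 y, y \in t & x = f y \/ x = g y}.
Proof.
elim: t r => //= x t IH r; rewrite inE => /orP[/eqP ->|/mapP[r' /IH[sr rP] ->]].
  split=> [|z]; first by rewrite /= size_map.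
  rewrite inE => /orP[/eqP ->|]; first by exists x; [exact: mem_head|left].
  rewrite inE => /orP[/eqP ->|/mapP[y yt ->]]; first by exists x; [exact: mem_head|right].
  by exists y; [rewrite inE yt orbT|right].
split=> [|z]; first by rewrite /= sr.
rewrite inE => /orP[/eqP ->|/rP[y yt yE]]; first by exists x; [exact: mem_head|left].
by exists y => //; rewrite inE yt orbT.
Qed.

Lemma suspends_ind (P : nat -> seq X -> Prop) h n (s : X -> X) C b :
  (forall t, t \in C -> P 0%N t) ->
  (forall b t, P b t -> P b (map s t)) ->
  (forall b t k r, (k < n)%N -> P b t -> size r = (size t).+1 ->
    {in r, forall x, exists2 y, y \in t & x = h b.+1 k y \/ x = h b.+1 k.+1 y} ->
    P b.+1 r) ->
  forall t, t \in suspends h n s b C -> P b t.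
Proof.
move=> P0 Ps Ph; elim: b => //= b IH t /flatten_mapP[t' t'C].
move=> /flatten_mapP[k]; rewrite mem_iota add0n => /andP[_ kn] /prism_mem[].
apply: Ph => //; move: t'C; rewrite mem_cat => /orP[/IH//|/mapP[t'' /IH ? ->]].
exact: Ps.
Qed.

End PrismMembers.

(** * Evaluation of a cup product on a product of hemispheres *)

Section Count.
Variables (X : eqType) (p : X) (n : nat).
Variables (s : 'I_3 -> X -> X) (h : 'I_3 -> nat -> nat -> X -> X).
Hypothesis sK : forall j, involutive (s j).
Hypothesis sC : forall i j x, s i (s j x) = s j (s i x).
Hypothesis h0 : forall j b, h j b 0%N =1 id.
Hypothesis hn : forall j b x, h j b n (s j x) = h j b n x.
Hypothesis hs : forall (i j : 'I_3) b k x, i != j -> h j b k (s i x) = s i (h j b k x).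

(* The product of hemispheres of dimensions [b j], see [bd_cells]. *)
Definition cells (b : 'I_3 -> nat) : seq (seq X) :=
  suspends (h 2) n (s 2) (b 2) (suspends (h 1) n (s 1) (b 1)
    (suspends (h 0) n (s 0) (b 0) [:: [:: p]])).

Definition lower (b : 'I_3 -> nat) (j : 'I_3) : 'I_3 -> nat :=
  fun i => if i == j then (b i).-1 else b i.

(** Each group of suspensions contributes by [bd_suspends], and the outer ones commute with the
    inner reflection. The condition on [phi] discards the augmentation of the base point. *)
Lemma bd_cells (phi : seq X -> 'F_2) b : phi [::] = 0 ->
  ev phi (lin (@bd X) (cells b)) =
  \sum_(j | (0 < b j)%N) ev phi (sym (s j) (cells (lower b j))).
Proof.
move=> phi0.
rewrite big_mkcond !big_ord_recl big_ord0 [LHS]lock /= -lock.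
have -> : @ord0 2 = 0 :> 'I_3 by exact: val_inj.
have -> : lift 0 ord0 = 1 :> 'I_3 by exact: val_inj.
have -> : lift 0 (lift ord0 ord0) = 2 :> 'I_3 by exact: val_inj.
rewrite addr0 addrA /cells.
rewrite bd_suspends//; try by [exact: h0|exact: hn|exact: sK].
rewrite ev_suspends bd_suspends//; try by [exact: h0|exact: hn|exact: sK].
rewrite ev_suspends bd_suspends//; try by [exact: h0|exact: hn|exact: sK].
rewrite [ev _ (suspends _ _ _ _ (lin _ _))]ev_suspends.
rewrite {1}/lin /= ev_cons ev_nil !suspends_dual_nil// !add0r.
have ss i j b' phi' C : i != j ->
    ev (suspends_dual (h j) n (s j) b' phi') (sym (s i) C) =
    ev phi' (sym (s i) (suspends (h j) n (s j) b' C)).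
  by move=> ij; rewrite -ev_suspends suspends_sym// => k m x; exact: hs.
congr (_ + _ + _); rewrite /lower /=.
- by case: (b 0) => // b'; rewrite !ss.
- by case: (b 1) => // b'; rewrite !ss.
- by case: (b 2).
Qed.

Lemma cells_ind (P : ('I_3 -> nat) -> seq X -> Prop) b :
  P (fun=> 0%N) [:: p] ->
  (forall j b t, P b t -> P b (map (s j) t)) ->
  (forall j b t k r, (k < n)%N -> P b t -> size r = (size t).+1 ->
    {in r, forall x, exists2 y, y \in t &
      x = h j (b j).+1 k y \/ x = h j (b j).+1 k.+1 y} ->
    P (fun i => if i == j then (b i).+1 else b i) r) ->
  forall t, t \in cells b -> P b t.
Proof.
move=> P0 Ps Ph t.
pose B b0 b1 b2 : 'I_3 -> nat := fun i => nth 0%N [:: b0; b1; b2] i.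
have -> : b = B (b 0) (b 1) (b 2).
  by apply/funext => -[[|[|[|//]]] i3]; congr b; exact: val_inj.
have B0 b0 b1 b2 : (fun i => if i == 0 then (B b0 b1 b2 i).+1 else B b0 b1 b2 i) = B b0.+1 b1 b2.
  by apply/funext => -[[|[|[|//]]] i3].
have B1 b0 b1 b2 : (fun i => if i == 1 then (B b0 b1 b2 i).+1 else B b0 b1 b2 i) = B b0 b1.+1 b2.
  by apply/funext => -[[|[|[|//]]] i3].
have B2 b0 b1 b2 : (fun i => if i == 2 then (B b0 b1 b2 i).+1 else B b0 b1 b2 i) = B b0 b1 b2.+1.
  by apply/funext => -[[|[|[|//]]] i3].
apply: (suspends_ind (P := fun c => P (B (b 0) (b 1) c))) => [{}t|c|]; last 2 first.
- exact: Ps.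
- by move=> c t' k r kn Pt sr rP; rewrite -B2; exact: Ph rP.
apply: (suspends_ind (P := fun c => P (B (b 0) c 0%N))) => [{}t|c|]; last 2 first.
- exact: Ps.
- by move=> c t' k r kn Pt sr rP; rewrite -B1; exact: Ph rP.
apply: (suspends_ind (P := fun c => P (B c 0%N 0%N))) => [{}t|c|]; last 2 first.
- exact: Ps.
- by move=> c t' k r kn Pt sr rP; rewrite -B0; exact: Ph rP.
rewrite inE => /eqP ->; rewrite (_ : B _ _ _ = fun=> 0%N)//.
by apply/funext => -[[|[|[|//]]] i3].
Qed.

Lemma cells_size b t : t \in cells b -> size t = (\sum_j b j).+1.
Proof.
apply: (cells_ind (P := fun b t => size t = (\sum_j b j).+1)) => [||j {}b {}t k r _ st sr _].
- by rewrite big1.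
- by move=> j {}b {}t; rewrite size_map.
rewrite sr st (bigD1 j)//= [in RHS](bigD1 j)//= eqxx addSn; congr (_ + _).+2.
by apply: eq_bigr => i /negPf ->.
Qed.

Variables (I : Type) (sg : I -> X -> 'F_2) (ch : I -> 'I_3 -> 'F_2).

(** The coefficient of x^b in the product over [L] of the linear forms with coefficients [ch l], see
    [mcoeff_prod_linear]. *)
Fixpoint coef (L : seq I) (b : 'I_3 -> nat) : 'F_2 :=
  if L is l :: L' then \sum_(j | (0 < b j)%N) ch l j * coef L' (lower b j)
  else ([forall j, b j == 0%N])%:R.

(** The constant shifts cancel in the differences that make up [cup], so only the leading factor
    [sg l] changes. *)
Lemma cup_sym l L j t : (forall l x, x \in t -> sg l (s j x) = sg l x + ch l j) ->
  scup sg l L t + scup sg l L (map (s j) t) = ch l j * cup sg L t.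
Proof.
move=> sgE; have -> : scup sg l L (map (s j) t) =
    if t is x :: _ then (sg l x + ch l j) * cup sg L t else 0.
  have -> : cup sg L t = cup sg L (map (s j) t).
    elim: L t sgE {l} => [|l L IH] [|x [|y t]] //= sgE.
    rewrite !sgE ?inE ?eqxx ?orbT// (IH (y :: t)).
      by congr (_ * _); rewrite addrACA addF2 addr0.
    by move=> l' z zt; apply: sgE; rewrite inE zt orbT.
  by case: t sgE => //= x t sgE; rewrite sgE ?inE ?eqxx.
case: t {sgE} => [|x t]; first by case: L => [|? ?]; rewrite mulr0 addr0.
by rewrite /= -mulrDl addrA addF2 add0r.
Qed.

(** Stokes: [cup (l :: L)] is the coboundary of [scup l L], which is evaluated on the spheres in the
    boundary by [cup_sym]. Equivariance is asked only at points of cells below [b], since sign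
    classes are equivariant only where all rows are nonzero. *)
Lemma cup_cells L b :
  (forall b' t l x j, t \in cells b' -> (forall j, b' j <= b j)%N -> x \in t ->
     sg l (s j x) = sg l x + ch l j) ->
  ev (cup sg L) (cells b) = coef L b.
Proof.
elim: L b => [|l L IH] b sgE.
  have sz := @cells_size b; rewrite /coef.
  (* The empty cup product is 1 on one-point tuples only, and these occur only in dimension 0. *)
  case: (boolP [forall j, b j == 0%N]) => [/forallP b0|/negP bN0].
    by rewrite /cells !(eqP (b0 _)) /= ev_cons ev_nil /= addr0.
  rewrite /ev big_seq big1// => t /sz; case: t => [|x [|y t]] //= [].
  move/esym/eqP; rewrite sum_nat_eq0 => /forallP b0.
  by case: bN0; apply/forallP => j; exact: b0.
rewrite (eq_ev _ (fun t => cup_scup l t (cup_bd sg L))) -ev_lin bd_cells//=.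
apply: eq_bigr => j bj; rewrite ev_sym -IH => [|b' t l' x i tb' b'b xt]; last first.
  apply: (sgE b' t) => // i'; apply: leq_trans (b'b i') _.
  by rewrite /lower; case: ifP => // _; exact: leq_pred.
rewrite -ev_mull /ev; apply: eq_big_seq => t tc; apply: cup_sym => l' x xt.
apply: (sgE (lower b j) t) => // i.
by rewrite /lower; case: ifP => // _; exact: leq_pred.
Qed.

End Count.

(** * Common zeros of equivariant functions *)

Section Zero.
Variables (R : realType) (d : nat).
Implicit Types (x y : 'M[R]_(3, d)) (i j : 'I_3).

Definition flip j x : 'M[R]_(3, d) :=
  \matrix_(i, l) (if i == j then - x i l else x i l).

(* The straight homotopy in row [j] towards the [b]-th basis vector, after [k]
   of [n] steps. *)
Definition pull n j (b k : nat) x : 'M[R]_(3, d) :=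
  \matrix_(i, l) (if i == j then (1 - k%:R / n%:R) * x i l + k%:R / n%:R * (l == b :> nat)%:R
                  else x i l).

Definition base : 'M[R]_(3, d) := \matrix_(i, l) (l == 0%N :> nat)%:R.

Lemma flipK j : involutive (flip j).
Proof. by move=> x; apply/matrixP => i l; rewrite !mxE; case: eqP; rewrite ?opprK. Qed.

Lemma flipC i j x : flip i (flip j x) = flip j (flip i x).
Proof. by apply/matrixP => i' l; rewrite !mxE; case: eqP; case: eqP. Qed.

Lemma pull0 n j b : pull n j b 0 =1 id.
Proof.
by move=> x; apply/matrixP => i l; rewrite !mxE mul0r subr0 mul1r mul0r addr0; case: eqP.
Qed.

Lemma pull_end n j b x : (0 < n)%N -> pull n j b n (flip j x) = pull n j b n x.
Proof.
move=> n0; apply/matrixP => i l; rewrite !mxE divff ?pnatr_eq0 -?lt0n//.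
by rewrite subrr !mul0r; case: eqP.
Qed.

Lemma pull_flip n i j b k x : i != j -> pull n j b k (flip i x) = flip i (pull n j b k x).
Proof.
move=> ij; apply/matrixP => i' l; rewrite !mxE; case: (eqVneq i' j) => // ->.
by rewrite eq_sym (negPf ij).
Qed.

Let cells n := cells base n flip (pull n).

Definition row_sphere x := forall j, \sum_(l < d) `|x j l| = 1.

Lemma cells_sphere n b t : (0 < n)%N -> (forall j, b j < d)%N -> t \in cells n b ->
  {in t, forall x, row_sphere x} /\
  {in t &, forall x y i l, `|x i l - y i l| <= (2 * \sum_j b j)%:R / n%:R}.
Proof.
move=> n0 bd tb.
(* The invariant also records that row [j] is supported on coordinates 0 to [b j]; the next pull
   goes to the basis vector of index [b j + 1], outside this support. *)
pose good (b : 'I_3 -> nat) (t : seq 'M[R]_(3, d)) := (forall j, b j < d)%N ->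
  {in t, forall x, row_sphere x /\ forall j (l : 'I_d), (b j < l)%N -> x j l = 0} /\
  {in t &, forall x y i l, `|x i l - y i l| <= (2 * \sum_j b j)%:R / n%:R}.
suff /(_ bd)[h1 h2] : good b t by split => // x /h1[].
have n0' : 0 < n%:R :> R by rewrite ltr0n.
have sumdelta c : (c < d)%N -> \sum_(l < d) `|(l == c :> nat)%:R : R| = 1.
  move=> cd; rewrite (bigD1 (Ordinal cd))//= eqxx normr1 big1 ?addr0// => l /eqP lc.
  by case: eqP => [e|_]; [case: lc; exact: val_inj|rewrite normr0].
apply: (cells_ind (P := good)) tb => [bd0|j {bd}b {}t tg bd|j {bd}b {}t k r kn tg _ rP bd].
- split=> [x|x y].
    rewrite inE => /eqP -> ; split => [j|j l l0]; last by rewrite mxE gtn_eqF.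
    by rewrite -[RHS](sumdelta _ (bd0 0)); apply: eq_bigr => l _; rewrite mxE.
  rewrite !inE => /eqP -> /eqP -> i l.
  by rewrite subrr normr0 divr_ge0.
- have [h1 h2] := tg bd; split=> [_ /mapP[x /h1[xs x0] ->]|_ _ /mapP[x xt ->] /mapP[y yt ->] i l].
    split=> [i|i l /x0 xil]; last by rewrite mxE xil oppr0 if_same.
    rewrite -[RHS](xs i); apply: eq_bigr => l _; rewrite mxE.
    by case: eqP; rewrite ?normrN.
  rewrite !mxE; case: eqP => _; last exact: h2.
  by rewrite -opprD normrN; exact: h2.
have bd' j' : (b j' < d)%N.
  by apply: leq_ltn_trans (bd j'); case: ifP.
have [h1 h2] := tg bd'.
have lam m : (m <= n)%N -> 0 <= (m%:R / n%:R : R) <= 1.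
  by move=> mn; rewrite divr_ge0//= ler_pdivrMr// mul1r ler_nat.
have bjd : ((b j).+1 < d)%N by have := bd j; rewrite eqxx.
have rP' : {in r, forall x, exists y m,
    [/\ y \in t, (k <= m <= k.+1)%N & x = pull n j (b j).+1 m y]}.
  by move=> x /rP[y yt [] ->]; exists y; [exists k|exists k.+1]; split; rewrite // ?leqnn ?leqnSn.
split=> [x /rP'[y [m [/h1[ys y0] /andP[_ mk] ->]]]
    |_ _ /rP'[x [m [xt mk ->]]] /rP'[y [m' [yt mk' ->]]] i l].
  have /andP[m0 m1] := lam m (leq_trans mk kn); set a := _ / _ in m0 m1.
  split=> [i|i l].
    case: (eqVneq i j) => [->|ij]; last first.
      by rewrite -[RHS](ys i); apply: eq_bigr => l _; rewrite mxE (negPf ij).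
    transitivity (\sum_(l < d) ((1 - a) * `|y j l| + a * `|(l == (b j).+1 :> nat)%:R : R|)).
      apply: eq_bigr => l _; rewrite mxE eqxx -/a.
      case: (eqVneq (l : nat) (b j).+1) => [lb|_].
        by rewrite y0 ?lb// normr0 !mulr0 !add0r normr1 ger0_norm ?mulr1.
      by rewrite normr0 mulr0 !addr0 normrM ger0_norm ?subr_ge0.
    by rewrite big_split -!mulr_sumr/= ys sumdelta// !mulr1 subrK.
  rewrite mxE; case: (eqVneq i j) => [->|ij] bl; last exact: y0.
  by rewrite y0 ?(ltn_trans _ bl)// gtn_eqF// !mulr0 addr0.
have -> : ((2 * \sum_j0 (if j0 == j then (b j0).+1 else b j0))%:R : R) = (2 * \sum_j b j)%:R + 2.
  rewrite (bigD1 j)//= eqxx [in RHS](bigD1 j)//= addSn mulnS addnC natrD; congr (_%:R + _).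
  by congr (2 * (_ + _))%N; apply: eq_bigr => i0 /negPf ->.
have h3 := h2 _ _ xt yt i l; rewrite mulrDl; set D := _ / _ in h3 *.
rewrite !mxE; case: eqP => [ij|_]; last by rewrite (le_trans h3)// lerDl divr_ge0.
have /andP[m0 m1] := lam m (leq_trans (andP mk).2 kn).
have entry z : z \in t -> `|z i l| <= 1.
  move=> /h1[zs _]; rewrite -(zs i) (bigD1 l)//= lerDl.
  exact: sumr_ge0.
have step : `|(m%:R / n%:R - m'%:R / n%:R : R)| <= n%:R^-1.
  rewrite -mulrBl normrM [`|n%:R^-1|]ger0_norm ?invr_ge0// ler_piMl ?invr_ge0//.
  have /andP[km mk1] := mk; have /andP[km' mk1'] := mk'.
  have : (m <= m' + 1)%N /\ (m' <= m + 1)%N by lia.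
  by rewrite -!(ler_nat R) !natrD ler_norml => -[? ?]; apply/andP; split; lra.
set a := m%:R / _ in m0 m1 step *; set a' := m'%:R / _ in step *.
set e : R := (_ == _)%:R.
(* The first term is bounded by the old diameter. In the second, the parameters differ by at most
   1/n and the entries by at most 2, so a suspension adds at most 2/n. *)
have -> : (1 - a) * x i l + a * e - ((1 - a') * y i l + a' * e) =
  (1 - a) * (x i l - y i l) + (a - a') * (e - y i l) by ring.
rewrite (le_trans (ler_normD _ _))// lerD// normrM.
  rewrite -[leRHS]mul1r ler_pM//; rewrite ger0_norm ?subr_ge0//; lra.
rewrite mulrC ler_pM// (le_trans (ler_normB _ _))// -[2]/(1 + 1) lerD ?entry//.
by rewrite /e; case: eqP; rewrite ?normr1 ?normr0.
Qed.

(** Bolzano-Weierstrass, transferred from row vectors by [mxvec]. *)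
Lemma matrix_cluster (m : nat) (v : nat -> 'M[R]_(m, d)) :
  (forall n (i : 'I_m) l, `|v n i l| <= 1) ->
  exists x : 'M[R]_(m, d), forall e N, 0 < e ->
    exists2 n, (N <= n)%N & forall (i : 'I_m) l, `|v n i l - x i l| < e.
Proof.
move=> v1.
have cA : compact [set w : 'rV[R]_(m * d) | forall a, `[-1, 1]%classic (w ord0 a)].
  apply: (@rV_compact R _ (fun=> `[-1, 1]%classic)) => a; exact: segment_compact.
have [|w [_ wc]] := cA ((fun n => mxvec (v n)) @ \oo).
  exists 0%N => // n _ i /=; rewrite in_itv/= -ler_norml.
  by case/mxvec_indexP: i => i j; rewrite mxvecE.
exists (vec_mx w) => e N e0.
have [|_ [[n /= Nn <-]]] := wc [set mxvec (v n) | n in [set n | (N <= n)%N]]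
  (ball w e) _ (nbhsx_ballx w e e0).
  by exists N => // n /= Nn; exists n.
move=> [_ bw]; exists n => // i l; rewrite mxE distrC.
by have := bw ord0 (mxvec_index i l); rewrite mxvecE.
Qed.

(* Exactly one of [r] and [- r] is negative. *)
Definition neg_row (r : 'rV[R]_d) : bool := choose (pred2 r (- r)) r != r.

(** The predicates for [r] and [- r] agree pointwise, so [choose] selects the same one of the two
    distinct vectors in both cases. *)
Lemma neg_rowN (r : 'rV[R]_d) : r != 0 -> neg_row (- r) = ~~ neg_row r.
Proof.
move=> r0; have rN : r != - r.
  apply: contra r0 => /eqP e; apply/eqP/matrixP => i l.
  by move/matrixP : e => /(_ i l); rewrite !mxE => h; lra.
rewrite /neg_row; have -> : choose (pred2 (- r) (- - r)) (- r) = choose (pred2 r (- r)) r.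
  rewrite (@eq_choose _ _ (pred2 r (- r))); last by move=> y /=; rewrite opprK orbC.
  by apply: choose_id => /=; rewrite eqxx ?orbT.
have /= : pred2 r (- r) (choose (pred2 r (- r)) r) by apply: chooseP; rewrite /= eqxx.
by move=> /orP[]/eqP ->; rewrite eqxx ?rN// eq_sym rN.
Qed.

Definition nonzero_rows x := forall j, row j x != 0.

Lemma row_sphere_nonzero x : row_sphere x -> nonzero_rows x.
Proof.
move=> xs j; apply/eqP => /matrixP e; have := xs j; rewrite big1 => [/eqP|l _].
  by rewrite eq_sym oner_eq0.
by have := e 0 l; rewrite !mxE => ->; rewrite normr0.
Qed.

(* The boxes depend continuously on their normals only away from zero normals. *)
Definition row_continuous (f : 'M[R]_(3, d) -> R) :=
  forall x, nonzero_rows x -> forall e, 0 < e -> exists2 a, 0 < a &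
    forall y, nonzero_rows y -> (forall i l, `|y i l - x i l| < a) -> `|f y - f x| < e.

Section EquivariantFunctions.
Variables (I : eqType) (ch : I -> 'I_3 -> bool) (f : I -> 'M[R]_(3, d) -> R).
Hypothesis f_flip : forall l j x, nonzero_rows x -> f l (flip j x) = (-1) ^+ ch l j * f l x.

Let chF l j : 'F_2 := (ch l j)%:R.

(* Where [f l] vanishes, the sign is chosen so that [sign_class_flip] holds. *)
Definition sign_class l x : 'F_2 :=
  if 0 < f l x then 0 else if f l x < 0 then 1
  else \sum_j chF l j * (neg_row (row j x))%:R.

Lemma sign_class_flip l j x : nonzero_rows x ->
  sign_class l (flip j x) = sign_class l x + chF l j.
Proof.
move=> x0; rewrite /sign_class f_flip//.
have rowE i : row i (flip j x) = if i == j then - row i x else row i x.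
  by apply/matrixP => a b; rewrite !mxE; case: eqP; rewrite !mxE.
have sumE : \sum_i chF l i * (neg_row (row i (flip j x)))%:R =
    \sum_i chF l i * (neg_row (row i x))%:R + chF l j.
  rewrite (bigD1 j)//= [in RHS](bigD1 j)//= rowE eqxx neg_rowN// addrAC.
  congr (_ + _); last by apply: eq_bigr => i /negPf ij; rewrite rowE ij.
  by case: neg_row; rewrite /= ?mulr0 ?mulr1 ?add0r ?addF2.
rewrite sumE /chF; case: (ch l j); rewrite ?expr1 ?expr0 ?mul1r ?addr0// mulN1r.
rewrite oppr_gt0 oppr_lt0; case: (ltgtP (f l x) 0) => //=; rewrite ?add0r// ?addF2//.
Qed.

(** A nonzero product has nonzero factors, and the factor of [l] compares two vertices of the
    tuple. *)
Lemma cup_sign_change (sg : I -> 'M[R]_(3, d) -> 'F_2) L t : cup sg L t != 0 ->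
  {in L, forall l, exists x y, [/\ x \in t, y \in t & sg l x != sg l y]}.
Proof.
elim: L t => // l L IH [|x [|y t]]; rewrite ?eqxx//= mulf_eq0 negb_or => /andP[xy ct] l'.
rewrite inE => /orP[/eqP ->|/(IH _ ct)[z [z' [zt zt' zz']]]].
  exists x, y; split; rewrite ?inE ?eqxx ?orbT//.
  by apply: contra xy => /eqP ->; rewrite addF2.
by exists z, z'; split => //; rewrite inE ?zt ?zt' orbT.
Qed.

Hypothesis f_cont : forall l, row_continuous (f l).

(** The nonzero count yields ever smaller tuples on which every sign class changes; a cluster point
    of their first vertices is a common zero. *)
Theorem equivariant_zero (L : seq I) (b : 'I_3 -> nat) :
  (forall j, b j < d)%N -> coef chF L b != 0 ->
  exists2 x, nonzero_rows x & {in L, forall l, f l x = 0}.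
Proof.
move=> bd cb.
have d0 : (0 < d)%N by apply: leq_ltn_trans (bd 0).
have ex n : exists t, [/\ t != [::], {in t, forall x, row_sphere x},
    {in t &, forall x y i l, `|x i l - y i l| <= (2 * \sum_j b j)%:R / n.+1%:R} &
    {in L, forall l, exists x y, [/\ x \in t, y \in t & sign_class l x != sign_class l y]}].
  have cc := @cup_cells _ base n.+1 flip (pull n.+1) flipK flipC (@pull0 n.+1)
    (fun j b x => pull_end j b x (ltn0Sn n)) (@pull_flip n.+1) _ sign_class chF L b.
  have [t tb tn] : exists2 t, t \in cells n.+1 b & cup sign_class L t != 0.
    apply/not_exists2P => tn; move/eqP: cb; apply; rewrite -cc.
      rewrite /ev big_seq big1// => t tb; have [//|/negP] := tn t.
      by rewrite negbK => /eqP.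
    move=> b' t l x j tb' b'b xt; apply: sign_class_flip; apply: row_sphere_nonzero.
    have b'd j' : (b' j' < d)%N by exact: leq_ltn_trans (b'b j') (bd j').
    by have [//|h1 _] := @cells_sphere n.+1 b' t _ b'd tb'; exact: h1.
  have [//|h1 h2] := @cells_sphere n.+1 b t _ bd tb.
  exists t; split => //; last exact: cup_sign_change.
  by apply/eqP => t0; move: (cells_size tb); rewrite t0.
have [t tP] := choice ex.
pose v n := head 0 (t n).
have vt n : v n \in t n 
  by rewrite /v; case: (tP n); case: (t n) => //= x s _ _ _ _; exact: mem_head.
have vs n : row_sphere (v n) by have [_ /(_ _ (vt n))] := tP n.
have [|x xP] := @matrix_cluster 3 v.
  move=> n i l; rewrite -(vs n i) (bigD1 l)//= lerDl; exact: sumr_ge0.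
have x0 : nonzero_rows x.
  move=> j; apply/eqP => /matrixP e.
  (* If row [j] of the limit were zero, row [j] of a nearby [v n] would have l1 norm at most 1/2
     instead of 1. *)
  have [|n _ nx] := xP (2 * d%:R)^-1 0%N; first by rewrite invr_gt0 mulr_gt0// ltr0n.
  have := vs n j; apply/eqP; rewrite lt_eqF//.
  apply: (@le_lt_trans _ _ (\sum_(l < d) (2 * d%:R)^-1)).
    apply: ler_sum => l _; have := nx j l; have := e 0 l.
    by rewrite !mxE => ->; rewrite subr0 => /ltW.
  rewrite sumr_const card_ord -[_ *+ _]mulr_natl invfM mulrCA divff ?mulr1 ?pnatr_eq0 -?lt0n//.
  by rewrite invf_lt1// ltr1n.
exists x => // l lL; apply/eqP/negPn/negP => fx0.
have [a a0 fa] := f_cont l x0 (e := `|f l x|) ltac:(by rewrite normr_gt0).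
(* Half of [a] is for the diameter of the tuple, the other half for the distance from [v n] to [x].
   Then [f l] has the sign of [f l x] on the whole tuple. *)
have [N NP] : exists N : nat, (2 * \sum_j b j)%:R / N.+1%:R < a / 2.
  exists (Num.truncn ((2 * \sum_j b j)%:R / (a / 2))).
  by rewrite ltr_pdivrMr ?ltr0n// mulrC -ltr_pdivrMr ?divr_gt0// truncnS_gt.
have [|n Nn nx] := xP (a / 2) N; first by rewrite divr_gt0.
have [_ ts tc /(_ _ lL)[y [z [yt zt]]]] := tP n.
have near y' : y' \in t n -> `|f l y' - f l x| < `|f l x|.
  move=> y't; apply: fa; first exact/row_sphere_nonzero/ts.
  move=> i l'; rewrite -(subrKA (v n i l')) [a]splitr (le_lt_trans (ler_normD _ _))// ltrD//.
  apply: le_lt_trans (tc _ _ y't (vt n) i l') _; apply: le_lt_trans NP.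
  by rewrite ler_wpM2l// lef_pV2 ?posrE ?ltr0n// ler_nat.
have := near _ yt; have := near _ zt; rewrite /sign_class !ltr_distl.
case: (ltgtP (f l x) 0) fx0 => // fx _;
  rewrite ?(ltr0_norm fx) ?(gtr0_norm fx) => /andP[h1 h2] /andP[h3 h4].
  have fy : f l y < 0 by lra.
  have fz : f l z < 0 by lra.
  by rewrite (lt_gtF fy) fy (lt_gtF fz) fz eqxx.
have fy : 0 < f l y by lra.
have fz : 0 < f l z by lra.
by rewrite fy fz eqxx.
Qed.

End EquivariantFunctions.
End Zero.

(** * The Dickson polynomial *)

Lemma addF2poly (p : F2poly3) : p + p = 0.
Proof. by apply/mpolyP => m; rewrite mcoeffD mcoeff0 addF2. Qed.

(** The exponents are 0, 1, 3: a Vandermonde product times the Schur polynomial x_1 + x_2 + x_3. *)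
Lemma det_lacunary_vandermonde (A : comNzRingType) (x : 'I_3 -> A) :
  \det (\matrix_(i < 3, j < 3) x i ^+ (2 ^ j).-1) =
  (x 1 - x 0) * (x 2 - x 0) * (x 2 - x 1) * (x 0 + x 1 + x 2).
Proof.
(* Indexing by natural numbers lets the indices in the cofactor expansions compute. *)
pose z a := x (inord a); pose y a b := z a ^+ (2 ^ b).-1.
set M := \matrix_(i, j) _.
have ME i j : M i j = y i j by rewrite mxE /y /z inord_val.
have xE (i : 'I_3) : x i = z i by rewrite /z inord_val.
clearbody M; rewrite !xE (expand_det_col _ 0) !big_ord_recl big_ord0 /cofactor.
rewrite !(expand_det_row _ ord0) !big_ord_recl !big_ord0 /cofactor !det_mx11 !mxE.
by rewrite !ME /= /bump /= /y /=; ring.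
Qed.

(** The product of all seven nonzero linear forms over Z/2; differences become sums modulo 2. *)
Lemma dickson3_factor : dickson3 = xvar 0 * xvar 1 * xvar 2 *
  ((xvar 0 + xvar 1) * (xvar 0 + xvar 2) * (xvar 1 + xvar 2) *
   (xvar 0 + xvar 1 + xvar 2)).
Proof.
rewrite dickson3E det_lacunary_vandermonde; congr (_ * _).
have N (p q : F2poly3) : p - q = q + p.
  by apply/eqP; rewrite subr_eq addrAC addF2poly add0r.
by rewrite !N.
Qed.

(** The two sides are compared in the fraction field, where [tofrac] is injective. Dividing by x_2
    x_3 lowers the exponent of these two forms from k + 1 to k. *)
Lemma obstruction_polyE k Q : obstruction_poly k Q ->
  Q = (xvar 1 * xvar 2) ^+ k *
    ((xvar 0 + xvar 1) * (xvar 0 + xvar 2) * (xvar 1 + xvar 2) *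
     (xvar 0 + xvar 1 + xvar 2)) ^+ k.+1.
Proof.
rewrite /obstruction_poly dickson3_factor => QE; apply/eqP; rewrite -tofrac_eq QE.
rewrite !(tofracM, tofracXn) -quotient_expE ?tofrac_xvar_neq0// !(tofracM, tofracXn).
Qed.

(** Used in contrapositive form: outside the ideal, some monomial of [Q] has all its exponents below
    [d]. *)
Lemma in_ideal_monomials (d : nat) (Q : F2poly3) :
  (forall m, m \in msupp Q -> exists j : 'I_3, (d <= m j)%N) ->
  in_ideal_of [:: xvar 0 ^+ d; xvar 1 ^+ d; xvar 2 ^+ d] Q.
Proof.
move=> Qd; pose P (p : F2poly3) := exists c : 'I_3 -> F2poly3, p = \sum_i c i * xvar i ^+ d.
suff [c ->] : P Q.
  by exists c; apply: eq_bigr => -[[|[|[|//]]] i] _; congr (c _ * xvar _ ^+ d); exact: val_inj.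
rewrite [Q]mpolyE big_seq; apply: big_ind => [|_ _ [c ->] [c' ->]|m /Qd[j dm]].
- by exists (fun=> 0); rewrite big1// => i _; rewrite mul0r.
- exists (fun i => c i + c' i); rewrite -big_split; apply: eq_bigr => i _.
  by rewrite mulrDl.
exists (fun i => if i == j then mcoeff m Q *: mpolyX _ (mnm_sub m (mnm_muln (mnm1 j) d)) else 0).
rewrite (bigD1 j)//= eqxx big1 ?addr0 => [|i /negPf ->]; last by rewrite mul0r.
rewrite /xvar mpolyXn -scalerAl -mpolyXD submK//; apply/mnm_lepP => i.
by rewrite mulmnE mnm1E; case: eqP => [<-|_]; rewrite ?mul1n ?mul0n.
Qed.

Section ProductCoefficients.
Variables (I : Type) (ch : I -> 'I_3 -> 'F_2).

Lemma mcoeff_xvarM (p : F2poly3) (j : 'I_3) m :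
  mcoeff m (xvar j * p) = if (0 < m j)%N then mcoeff (mnm_sub m (mnm1 j)) p else 0.
Proof.
rewrite mulrC /xvar; case: ifP => mj.
  rewrite -[in LHS](@submK _ (mnm1 j) m) 1?addmC ?mcoeffMX//; apply/mnm_lepP => i.
  by rewrite mnm1E; case: eqP => [<-|].
apply/memN_msupp_eq0; rewrite (perm_mem (msuppMX _ _)); apply/mapP => -[m' _ me].
by move: mj; rewrite me mnmDE mnm1E eqxx.
Qed.

Lemma mcoeff_prod_linear (L : seq I) m :
  mcoeff m (\prod_(l <- L) \sum_j ch l j *: xvar j) = coef ch L (fun j => m j).
Proof.
elim: L m => [|l L IH] m.
  rewrite big_nil mcoeff1 /=; congr (_%:R); congr nat_of_bool.
  apply/eqP/forallP => [-> j|m0]; first by rewrite mnm0E.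
  by apply/mnmP => j; rewrite mnm0E; exact/eqP.
rewrite big_cons mulr_suml raddf_sum /= [RHS]big_mkcond; apply: eq_bigr => j _.
rewrite -scalerAl mcoeffZ mcoeff_xvarM; case: ifP => mj; last by rewrite mulr0.
rewrite IH; congr (_ * coef _ _ _); apply/funext => i.
by rewrite mnmBE mnm1E /lower eq_sym; case: eqP; rewrite ?subn1 ?subn0.
Qed.

End ProductCoefficients.

(** * Mass of half-spaces *)

Section Dot.
Variables (R : realType) (d : nat).
Implicit Types u x : 'rV[R]_d.

Lemma dotRVN u x : dotRV (- u) x = - dotRV u x.
Proof. by rewrite /dotRV -sumrN; apply: eq_bigr => i _; rewrite mxE mulNr. Qed.

Lemma dotRV_continuous u : continuous (dotRV u).
Proof.
apply: continuous_big => [|i _].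
  by move=> z; apply: cvgD; [exact: cvg_fst|exact: cvg_snd].
move=> x; apply: (@continuous_comp _ _ _ (fun x : 'rV[R]_d => x 0 i) ( *%R (u 0 i))).
  exact: coord_continuous.
exact: mulrl_continuous.
Qed.

Lemma measurable_dotRV u : measurable_fun [set: borelRV R d] (dotRV u).
Proof.
apply: measurable_sum => i; apply: measurable_funM => //.
exact: measurable_coordRV.
Qed.

Lemma measurable_le_set (f g : borelRV R d -> R) :
  measurable_fun setT f -> measurable_fun setT g ->
  measurable [set x | f x <= g x].
Proof.
move=> mf mg; rewrite (_ : [set _ | _] = (fun x => f x <= g x) @^-1` [set true]).
  by rewrite -[X in measurable X]setTI; apply: measurable_fun_ler.
by apply/seteqP; split.
Qed.

Lemma dotRV_surj u a : u != 0 -> exists x, dotRV u x = a.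
Proof.
move=> u0; have [i ui] : exists i, u 0 i != 0.
  apply/existsP; apply: contraR u0 => /existsPn u0; apply/eqP/rowP => i.
  by rewrite mxE; apply/eqP/negPn.
exists (\row_j (a / u 0 i * (i == j)%:R)).
rewrite /dotRV (bigD1 i)//= mxE eqxx mulr1 big1 ?addr0 => [|j ji].
  by rewrite mulrC divfK.
by rewrite mxE eq_sym (negPf ji) !mulr0.
Qed.

End Dot.

(** Induction on [d] by sections. If the tail of the normal is nonzero, every section is a
    hyperplane; otherwise only the section at c / a is nonempty, and a point is a null set. *)
Lemma lebesgueRV_hyperplane (R : realType) (d : nat) (u : 'rV[R]_d) (c : R) :
  u != 0 -> lebesgueRV ([set x | dotRV u x = c] : set (borelRV R d)) = 0%E.
Proof.
elim: d u c => [u c|d IH u c u0]; first by rewrite thinmx0 eqxx.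
pose u' : 'rV[R]_d := @rsubmx R 1 1 d u.
pose a := @lsubmx R 1 1 d u 0 0.
have dotE x (v : 'rV[R]_d) :
    dotRV u (row_mx (const_mx x : 'rV[R]_1) v : 'rV[R]_(1 + d)) = a * x + dotRV u' v.
  rewrite /dotRV (@big_split_ord _ _ _ 1 d) big_ord1; congr (_ + _).
    congr (_ * _); last by rewrite [LHS]row_mxEl mxE.
    by rewrite /a [RHS]mxE; congr (fun_of_matrix u _ _); exact: val_inj.
  apply: eq_bigr => i _; congr (_ * _); last by rewrite [LHS]row_mxEr.
  by rewrite [RHS]mxE.
rewrite /=; have [u'0|u'0] := eqVneq u' 0; last first.
  apply: integral0_eq => x _; rewrite -[RHS](IH u' (c - a * x) u'0).
  congr lebesgueRV; apply/seteqP; split => v /=; rewrite dotE.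
    by move=> <-; ring.
  by move=> ->; ring.
have a0 : a != 0.
  apply: contra u0 => /eqP a0; apply/eqP; rewrite -[u](@hsubmxK R 1 1 d) -/u' u'0.
  rewrite (_ : lsubmx _ = 0) ?row_mx0//; apply/matrixP => i j.
  by rewrite !ord1 [RHS]mxE -[RHS]a0.
rewrite -[RHS](integral_set1 (fun x => lebesgueRV [set v : 'rV[R]_d |
  dotRV u (row_mx (const_mx x : 'rV[R]_1) v : 'rV[R]_(1 + d)) = c]) (c / a)).
rewrite [RHS]integral_mkcond; apply: eq_integral => x _; rewrite patchE.
case: ifPn => //; rewrite notin_setE /= => xc.
rewrite (_ : [set _ | _] = set0) ?measure0//.
apply/seteqP; split => // v /=; rewrite dotE u'0 (_ : dotRV 0 v = 0).
  by rewrite addr0 => e; apply: xc; rewrite -e mulrC mulKf.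
by rewrite /dotRV big1// => i _; rewrite mxE mul0r.
Qed.

Section Mass.
Variables (R : realType) (d : nat).
Variable mu : {finite_measure set (borelRV R d) -> \bar R}.
Implicit Types (A B C S : set (borelRV R d)) (u x : 'rV[R]_d) (c p e : R).

Definition mass A : R := fine (mu A).

Lemma massE A : measurable A -> mu A = (mass A)%:E.
Proof. by move=> mA; rewrite /mass fineK// fin_num_measure. Qed.

Lemma mass_ge0 A : 0 <= mass A.
Proof. exact: fine_ge0. Qed.

Lemma mass_le A B : measurable A -> measurable B -> A `<=` B -> mass A <= mass B.
Proof. by move=> mA mB AB; rewrite -lee_fin -!massE// le_measure ?inE. Qed.

Lemma mass0 : mass set0 = 0.
Proof. by rewrite /mass measure0. Qed.

Lemma massDI A B : measurable A -> measurable B ->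
  mass A = mass (A `\` B) + mass (A `&` B).
Proof.
move=> mA mB; apply: EFin_inj; rewrite EFinD -!massE//; last 2 first.
- exact: measurableI.
- exact: measurableD.
exact: measureDI.
Qed.

Lemma massU_le A B : measurable A -> measurable B -> mass (A `|` B) <= mass A + mass B.
Proof.
move=> mA mB; rewrite (massDI (B := A))//; last exact: measurableU.
have mAB : measurable (A `|` B) by exact: measurableU.
rewrite addrC lerD// mass_le//; try by [exact: measurableI|exact: measurableD].
by move=> x [[]].
Qed.

Lemma mass_dist A B S : measurable A -> measurable B -> measurable S ->
  (forall x, ~ S x -> (A x <-> B x)) -> `|mass A - mass B| <= mass S.
Proof.
move=> mA mB mS AB; rewrite (massDI mA mS) (massDI mB mS).
have -> : A `\` S = B `\` S.
  by apply/seteqP; split => x [? nS]; split => //; have [h1 h2] := AB _ nS; auto.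
have h C : measurable C -> 0 <= mass (C `&` S) <= mass S.
  by move=> mC; rewrite mass_ge0 mass_le//; exact: measurableI.
have /andP[? ?] := h _ mA; have /andP[? ?] := h _ mB.
by rewrite ler_norml; apply/andP; split; lra.
Qed.

Lemma mass_eq A B S : measurable A -> measurable B -> measurable S -> mass S = 0 ->
  (forall x, ~ S x -> (A x <-> B x)) -> mass A = mass B.
Proof.
move=> mA mB mS S0 AB; have := mass_dist mA mB mS AB.
by rewrite S0 normr_le0 subr_eq0 => /eqP.
Qed.

(** Additivity up to a null overlap, as needed for closed half-spaces and regions. *)
Lemma massD A B C S : measurable A -> measurable B -> measurable C -> measurable S ->
  mass S = 0 -> (forall x, C x <-> A x \/ B x) -> (forall x, A x -> B x -> S x) ->
  mass C = mass A + mass B.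
Proof.
move=> mA mB mC mS S0 CAB ABS; rewrite (massDI mC mA) addrC.
have -> : C `&` A = A.
  by apply/seteqP; split => x; [case|move=> Ax; split => //; apply/CAB; left].
congr (_ + _); apply: (mass_eq _ mB mS S0) => [|x nSx]; first exact: measurableD.
have [h1 h2] := CAB x; split => [[/h1[]//]|Bx]; split; first by apply: h2; right.
by move=> Ax; apply: nSx; exact: ABS.
Qed.

Lemma mass_small (F : (set (borelRV R d)) ^nat) e : (forall n, measurable (F n)) ->
  nonincreasing_seq F -> mass (\bigcap_n F n) = 0 -> 0 < e -> exists n, mass (F n) < e.
Proof.
move=> mF nF F0 e0.
have mcap : measurable (\bigcap_n F n) by exact: bigcapT_measurable.
have F0oo : (mu (F 0%N) < +oo)%E by rewrite massE// ltry.
have : mu (F n) @[n --> \oo] --> (mass (\bigcap_n F n))%:E.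
  by rewrite -massE//; exact: nonincreasing_cvg_mu.
rewrite F0 => /fine_cvg/cvgrPdist_lt/(_ _ e0)[n _ /(_ n (leqnn n))] /= h.
by exists n; move: h; rewrite sub0r normrN ger0_norm// mass_ge0.
Qed.

Definition l1norm x : R := \sum_i `|x 0 i|.

Lemma l1norm_ge0 x : 0 <= l1norm x.
Proof. exact: sumr_ge0. Qed.

Lemma measurable_l1norm : measurable_fun [set: borelRV R d] l1norm.
Proof.
apply: measurable_sum => i; apply: measurableT_comp => //; exact: measurable_coordRV.
Qed.

(** The width grows with [x] because changing the entries of the normal by at most [e] changes
    [dotRV u x] by up to [e * l1norm x]. *)
Definition slab u c e : set (borelRV R d) :=
  [set x | `|dotRV u x - c| <= e * (1 + l1norm x)].

Lemma measurable_slab u c e : measurable (slab u c e).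
Proof.
apply: measurable_le_set.
  apply: measurableT_comp => //; apply: measurable_funB => //; exact: measurable_dotRV.
by apply: measurable_funM => //; apply: measurable_funD => //; exact: measurable_l1norm.
Qed.

Lemma slab_le u c e e' : e <= e' -> slab u c e `<=` slab u c e'.
Proof.
move=> ee' x /= h; apply: le_trans h _; rewrite ler_wpM2r// addr_ge0//.
exact: l1norm_ge0.
Qed.

(* Outside a slab around the hyperplane (u0, c0), all nearby hyperplanes leave a
   point on the same side as (u0, c0) does. *)
Lemma slab_side u0 c0 e u c x : (forall i, `|u 0 i - u0 0 i| < e) -> `|c - c0| < e ->
  ~ slab u0 c0 e x ->
  (dotRV u x <= c <-> dotRV u0 x <= c0) /\ (c <= dotRV u x <-> c0 <= dotRV u0 x).
Proof.
move=> ue ce /negP; rewrite -ltNge => sx.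
have h : `|dotRV u x - dotRV u0 x| <= e * l1norm x.
  rewrite /dotRV -sumrB /l1norm mulr_sumr (le_trans (ler_norm_sum _ _ _))//.
  by apply: ler_sum => i _; rewrite -mulrBl normrM ler_wpM2r// ltW.
move: sx h ce; rewrite mulrDr mulr1 !ler_norml !ltr_norml.
set L := e * l1norm x => + /andP[h1 h2] /andP[h3 h4].
by rewrite ltr_normr => /orP[] h5; split; split => ?; lra.
Qed.

Hypothesis hmu : mass_distribution mu.

Lemma mass_hyperplane u c : u != 0 -> mass [set x | dotRV u x = c] = 0.
Proof.
move=> u0; have [[f [fi fE]] _] := hmu.
have mh : measurable ([set x | dotRV u x = c] : set (borelRV R d)).
  rewrite (_ : [set _ | _] = dotRV u @^-1` [set c]); last by apply/seteqP; split.
  by rewrite -[X in measurable X]setTI; apply: measurable_dotRV.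
rewrite /mass fE// null_set_integral//; last exact: lebesgueRV_hyperplane.
by apply: measurable_funS (measurable_int _ fi).
Qed.

Lemma measurable_hyperplane u c : measurable ([set x | dotRV u x = c] : set (borelRV R d)).
Proof.
rewrite (_ : [set _ | _] = dotRV u @^-1` [set c]); last by apply/seteqP; split.
by rewrite -[X in measurable X]setTI; apply: measurable_dotRV.
Qed.

(** The slabs decrease to the hyperplane, which is a null set. *)
Lemma slab_small u c e : u != 0 -> 0 < e -> exists2 a, 0 < a & mass (slab u c a) < e.
Proof.
move=> u0 e0; have [|||n nP] := @mass_small (fun n => slab u c n.+1%:R^-1) e _ _ _ e0.
- by move=> n; exact: measurable_slab.
- apply/nonincreasing_seqP => n; apply/subsetPset/slab_le.
  by rewrite lef_pV2 ?posrE// ler_nat.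
- rewrite (_ : \bigcap_n _ = [set x | dotRV u x = c]) ?mass_hyperplane//.
  apply/seteqP; split => x /= => [h|xc]; last first.
    by move=> n _; rewrite /slab /= xc subrr normr0 mulr_ge0 ?invr_ge0// addr_ge0// l1norm_ge0.
  apply/eqP; rewrite -subr_eq0 -normr_le0; apply/ler_addgt0Pr => a a0; rewrite add0r.
  have l0 : 0 < 1 + l1norm x by rewrite ltr_pwDl// l1norm_ge0.
  have := h (Num.truncn ((1 + l1norm x) / a)) I; rewrite /slab /= => /le_trans; apply.
  rewrite mulrC ler_pdivrMr// mulrC -ler_pdivrMr//; exact/ltW/truncnS_gt.
by exists n.+1%:R^-1.
Qed.

Definition below u c : set (borelRV R d) := [set x | dotRV u x <= c].

Lemma measurable_below u c : measurable (below u c).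
Proof. by apply: measurable_le_set => //; exact: measurable_dotRV. Qed.

Lemma below_near u0 c0 e : u0 != 0 -> 0 < e -> exists2 a, 0 < a &
  forall u c, (forall i, `|u 0 i - u0 0 i| < a) -> `|c - c0| < a ->
    `|mass (below u c) - mass (below u0 c0)| < e.
Proof.
move=> u0n e0; have [a a0 aP] := slab_small c0 u0n e0; exists a => // u c ua ca.
apply: le_lt_trans aP; apply: mass_dist; try exact: measurable_below.
  exact: measurable_slab.
by move=> x xs; have [] := slab_side ua ca xs.
Qed.

Lemma below_small u e : 0 < e -> exists c, mass (below u c) < e.
Proof.
move=> e0; have [|||n nP] := @mass_small (fun n => below u (- n%:R)) e _ _ _ e0.
- by move=> n; exact: measurable_below.
- apply/nonincreasing_seqP => n; apply/subsetPset => x /= /le_trans; apply.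
  by rewrite lerN2 ler_nat.
- rewrite (_ : \bigcap_n _ = set0) ?mass0//; apply/seteqP; split => // x h.
  have := h (Num.truncn (- dotRV u x)).+1 I; rewrite /below /= lerNr leNgt.
  by rewrite truncnS_gt.
by exists (- n%:R).
Qed.

Lemma mass_belowN u c : u != 0 -> mass (below (- u) (- c)) = mass setT - mass (below u c).
Proof.
move=> u0; apply/eqP; rewrite eq_sym subr_eq; apply/eqP.
apply: massD (mass_hyperplane c u0) _ _ => //; try exact: measurable_below.
- exact: measurable_hyperplane.
- move=> x; split => // _; rewrite /below /= dotRVN lerN2.
  by case: (leP c (dotRV u x)) => [|/ltW]; [left|right].
- by move=> x; rewrite /below /= dotRVN lerN2 => h1 h2; apply/eqP; rewrite eq_le h1 h2.
Qed.

Lemma mass_open_gt0 A : open (A : set 'rV[R]_d) -> A !=set0 -> 0 < mass A.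
Proof.
move=> oA A0; have [_ /(_ _ oA A0)] := hmu; rewrite massE//.
exact: sub_sigma_algebra.
Qed.

Lemma massT_gt0 : 0 < mass setT.
Proof. by apply: mass_open_gt0; [exact: openT|exists 0]. Qed.

(** The open strip between the two levels is nonempty, hence of positive mass. *)
Lemma below_lt u c c' : u != 0 -> c < c' -> mass (below u c) < mass (below u c').
Proof.
move=> u0 cc'; pose O : set (borelRV R d) := dotRV u @^-1` `]c, c'[.
have oO : open (O : set 'rV[R]_d).
  by apply: open_comp; [move=> x _; exact: dotRV_continuous|exact: interval_open].
have mO : measurable O by exact: sub_sigma_algebra.
have : 0 < mass O.
  apply: mass_open_gt0 => //; have [x xE] := dotRV_surj ((c + c') / 2) u0.
  by exists x; rewrite /O /= xE in_itv/=; apply/andP; split; lra.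
rewrite (massDI (A := below u c') (B := below u c)); try exact: measurable_below.
rewrite (_ : below u c' `&` below u c = below u c); last first.
  by apply/seteqP; split => x [] //= h; split => //; apply: le_trans h (ltW cc').
move=> O0; rewrite ltrDr (lt_le_trans O0)// mass_le//.
  by apply: measurableD; exact: measurable_below.
move=> x; rewrite /O /= in_itv/= => /andP[h1 h2]; split; first exact: ltW.
by rewrite /below /= leNgt h1.
Qed.

Lemma below_inj u c c' : u != 0 -> mass (below u c) = mass (below u c') -> c = c'.
Proof.
move=> u0 e; case: (ltgtP c c') => // /(below_lt u0); by rewrite e ltxx.
Qed.

(** For nonzero [u] at most one level qualifies, by [below_inj]; the value is 0 if there is none. *)
Definition quantile p u : R := xget 0 [set c | mass (below u c) = p * mass setT].

Lemma quantileP p u : u != 0 -> 0 < p < 1 ->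
  mass (below u (quantile p u)) = p * mass setT.
Proof.
move=> u0 /andP[p0 p1]; have T0 := massT_gt0.
suff [c cP] : exists c, mass (below u c) = p * mass setT 
  by have := @xgetI _ 0 [set c | mass (below u c) = p * mass setT] c cP.
have [a aP] := below_small u (mulr_gt0 p0 T0).
(* The upper end for the intermediate value theorem is a lower end for the opposite normal. *)
have [b' b'P] : exists c, mass (below (- u) c) < (1 - p) * mass setT.
  by apply: below_small; rewrite mulr_gt0// subr_gt0.
have bP : p * mass setT < mass (below u (- b')).
  by move: b'P; rewrite -{1}[b']opprK mass_belowN// mulrBl mul1r; lra.
have ab : a <= - b'.
  by rewrite leNgt; apply/negP => /(below_lt u0); lra.
have [||c _ cE] := @IVT R (fun c => mass (below u c)) a (- b') (p * mass setT) ab _ _; last 1 first.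
- by exists c.
- apply: continuous_subspaceT => c; apply/cvgrPdist_lt => e e0.
  have [r r0 rP] := below_near c u0 e0; near=> c'.
  rewrite distrC; apply: rP => [i|]; first by rewrite subrr normr0.
  by near: c'; exists r => //= c'; rewrite /ball_/= distrC.
- by rewrite ge_min (ltW aP) le_max (ltW bP) orbT.
Unshelve. all: by end_near.
Qed.

Lemma quantile_unique p u c : u != 0 -> 0 < p < 1 ->
  mass (below u c) = p * mass setT -> quantile p u = c.
Proof. by move=> u0 p01 cE; apply: (below_inj u0); rewrite quantileP. Qed.

Lemma quantileN p u : u != 0 -> 0 < p < 1 -> quantile p (- u) = - quantile (1 - p) u.
Proof.
move=> u0 p01; have p01' : 0 < 1 - p < 1 by move: p01 => /andP[? ?]; apply/andP; split; lra.
apply: quantile_unique => //; first by rewrite oppr_eq0.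
by rewrite mass_belowN// quantileP//; ring.
Qed.

Lemma quantile_lt p p' u : u != 0 -> 0 < p -> p < p' -> p' < 1 ->
  quantile p u < quantile p' u.
Proof.
move=> u0 p0 pp' p1; rewrite ltNge; apply/negP; rewrite le_eqVlt.
have : mass (below u (quantile p u)) < mass (below u (quantile p' u)).
  by rewrite !quantileP// ?ltr_pM2r ?massT_gt0 ?p1 ?p0 ?(lt_trans p0)//= (lt_trans pp').
by move=> h /orP[/eqP e|/(below_lt u0)]; [move: h; rewrite e ltxx|lra].
Qed.

(** At the levels [q - e / 2] and [q + e / 2] the mass differs strictly from the target; this
    persists for nearby normals, and monotonicity traps their quantile in between. *)
Lemma quantile_near p u0 e : 0 < p < 1 -> u0 != 0 -> 0 < e -> exists2 a, 0 < a &
  forall u, u != 0 -> (forall i, `|u 0 i - u0 0 i| < a) ->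
    `|quantile p u - quantile p u0| < e.
Proof.
move=> p01 u0n e0; set q := quantile p u0.
have e20 : 0 < e / 2 by lra.
have lo : mass (below u0 (q - e / 2)) < p * mass setT.
  by rewrite -(quantileP u0n p01) -/q; apply: below_lt => //; lra.
have hi : p * mass setT < mass (below u0 (q + e / 2)).
  by rewrite -(quantileP u0n p01) -/q; apply: below_lt => //; lra.
rewrite -subr_gt0 in lo; rewrite -subr_gt0 in hi.
have [a a0 aP] := below_near (q - e / 2) u0n lo.
have [b b0 bP] := below_near (q + e / 2) u0n hi.
exists (Num.min a b); first by rewrite lt_min a0 b0.
move=> u un uu0.
have ua i : `|u 0 i - u0 0 i| < a by have := uu0 i; rewrite lt_min => /andP[].
have ub i : `|u 0 i - u0 0 i| < b by have := uu0 i; rewrite lt_min => /andP[].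
have := aP u (q - e / 2) ua; have := bP u (q + e / 2) ub.
rewrite !subrr !normr0 => /(_ b0) h1 /(_ a0) h2.
have qP := quantileP un p01.
rewrite ltr_distl; apply/andP; split.
  suff : q - e / 2 < quantile p u by lra.
  rewrite ltNge; apply/negP; rewrite le_eqVlt => /orP[/eqP qe|/(below_lt un)].
    by move: h2; rewrite -qe qP ltr_distl; lra.
  by move: h2; rewrite qP ltr_distl; lra.
suff : quantile p u < q + e / 2 by lra.
rewrite ltNge; apply/negP; rewrite le_eqVlt => /orP[/eqP qe|/(below_lt un)].
  by move: h1; rewrite qe qP ltr_distl; lra.
by move: h1; rewrite qP ltr_distl; lra.
Qed.

End Mass.

(** * Boxes *)

Lemma finite_radius (R : realType) (T : finType) (r : T -> R) :
  (forall a, 0 < r a) -> exists2 e, 0 < e & forall a, e <= r a.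
Proof.
move=> r0; suff [e e0 eP] : exists2 e, 0 < e & {in enum T, forall a, e <= r a}.
  by exists e => // a; apply: eP; rewrite mem_enum.
elim: (enum T) => [|a s [e e0 eP]]; first by exists 1.
exists (Num.min (r a) e); first by rewrite lt_min r0.
move=> b; rewrite inE ge_min => /orP[/eqP ->|/eP ->]; rewrite ?lexx ?orbT//.
Qed.

Section Regions.
Variables (R : realType) (d : nat).
Variable mu : {finite_measure set (borelRV R d) -> \bar R}.
Hypothesis hmu : mass_distribution mu.
Implicit Types (u v : 'rV[R]_d).

Local Notation mass := (mass mu).

Lemma measurable_halfspace s u c : measurable (halfspace s u c : set (borelRV R d)).
Proof.
by case: s; [apply: measurable_le_set => //; exact: measurable_dotRV|exact: measurable_below].
Qed.

Lemma measurable_region l u (c : 'I_l -> R) j :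
  measurable (region u c j : set (borelRV R d)).
Proof.
rewrite (_ : region u c j = \bigcap_(i in [set: 'I_l]) halfspace (i < j)%N u (c i)).
  by apply: fin_bigcap_measurable => // i _; exact: measurable_halfspace.
by apply/seteqP; split => x h i; [move=> _; exact: h|exact: (h i I)].
Qed.

Lemma halfspaceN s u c : halfspace s (- u) (- c) = halfspace (~~ s) u c.
Proof.
by apply/seteqP; split => x; rewrite /halfspace /= dotRVN; case: s => /=; rewrite lerN2.
Qed.

Lemma mass_halfspaces u c (A : set (borelRV R d)) : u != 0 -> measurable A ->
  mass A = mass (A `&` halfspace false u c) + mass (A `&` halfspace true u c).
Proof.
move=> u0 mA; apply: massD (mass_hyperplane hmu c u0) _ _ => //.
- by apply: measurableI => //; exact: measurable_halfspace.
- by apply: measurableI => //; exact: measurable_halfspace.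
- exact: measurable_hyperplane.
- move=> x; split => [Ax|[[]|[]]//]; rewrite /halfspace /=.
  by case: (leP c (dotRV u x)) => [|/ltW]; [right|left].
- by move=> x [_ h1] [_ h2]; apply/eqP; rewrite eq_le h1 h2.
Qed.

(* For increasing [c], the union of the regions of index at most [j]. *)
Definition lower_regions l u (c : 'I_l -> R) (j : nat) : set (borelRV R d) :=
  [set x | forall i : 'I_l, (j <= i)%N -> dotRV u x <= c i].

Lemma measurable_lower_regions l u (c : 'I_l -> R) j : measurable (lower_regions u c j).
Proof.
rewrite (_ : lower_regions u c j =
    \bigcap_(i in [set i : 'I_l | (j <= i)%N]) halfspace false u (c i)).
  by apply: fin_bigcap_measurable => // i _; exact: measurable_halfspace.
by apply/seteqP; split => x h i; exact: h.
Qed.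

Lemma mass_lower_regionsS l u (c : 'I_l -> R) (j : 'I_l) (A : set (borelRV R d)) :
  u != 0 -> measurable A -> (forall i i' : 'I_l, (i < i')%N -> c i < c i') ->
  mass (A `&` lower_regions u c j.+1) =
  mass (A `&` lower_regions u c j) + mass (A `&` region u c (lift ord0 j)).
Proof.
move=> u0 mA cI.
have cle (i : 'I_l) : (j <= i)%N -> c j <= c i.
  by rewrite leq_eqVlt => /orP[/eqP/val_inj -> //|/cI/ltW].
have cge (i : 'I_l) : (i <= j)%N -> c i <= c j.
  by rewrite leq_eqVlt => /orP[/eqP/val_inj -> //|/cI/ltW].
apply: massD (mass_hyperplane hmu (c j) u0) _ _.
- by apply: measurableI => //; exact: measurable_lower_regions.
- by apply: measurableI => //; exact: measurable_region.
- by apply: measurableI => //; exact: measurable_lower_regions.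
- exact: measurable_hyperplane.
- move=> x; split => [[Ax Kx]|[[Ax Kx]|[Ax Kx]]]; last 2 first.
  + by split => // i ji; apply: Kx; exact: ltnW.
  + by split => // i ji; have := Kx i; rewrite lift0 ltnS leqNgt ji.
  case: (leP (dotRV u x) (c j)) => xc; [left|right]; split => // i.
    by move=> /cle; exact: le_trans.
  rewrite lift0 ltnS; case: leqP => [/cge ij|]; last exact: Kx.
  exact: le_trans ij (ltW xc).
- move=> x [_ Kx] [_ Rx]; apply/eqP; rewrite eq_le Kx//=.
  by have := Rx j; rewrite lift0 ltnS leqnn.
Qed.

Lemma lower_regions0 l u (c : 'I_l -> R) : lower_regions u c 0 = region u c ord0.
Proof. by apply/seteqP; split => x h i; [exact: h|move=> _; exact: h]. Qed.

Lemma lower_regions_all l u (c : 'I_l -> R) : lower_regions u c l = setT.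
Proof. by apply/seteqP; split => // x _ i; rewrite leqNgt ltn_ord. Qed.

Lemma sum_mass_regions l u (c : 'I_l -> R) (A : set (borelRV R d)) :
  u != 0 -> measurable A -> (forall i i' : 'I_l, (i < i')%N -> c i < c i') ->
  \sum_j mass (A `&` region u c j) = mass A.
Proof.
move=> u0 mA cI; rewrite -[in RHS](setIT A) -(lower_regions_all u c).
pose K j := mass (A `&` lower_regions u c j).
rewrite big_ord_recl -lower_regions0 -/(K 0%N) -/(K l).
rewrite (eq_bigr (fun j : 'I_l => K j.+1 - K j)); last first.
  by move=> j _; rewrite /K mass_lower_regionsS// addrAC subrr add0r.
rewrite -(big_mkord xpredT (fun j => K j.+1 - K j)) telescope_sumr//.
by rewrite addrC subrK.
Qed.

Definition cuts l u (i : 'I_l) : R := quantile mu (i.+1%:R / l.+1%:R) u.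
Arguments cuts : clear implicits.

Lemma cut_level l (i : 'I_l) : 0 < (i.+1%:R / l.+1%:R : R) < 1.
Proof. by rewrite divr_gt0//= ltr_pdivrMr// mul1r ltr_nat ltnS ltn_ord. Qed.

Lemma cuts_lt l u : u != 0 -> forall i i' : 'I_l, (i < i')%N -> cuts l u i < cuts l u i'.
Proof.
move=> u0 i i' ii'; have /andP[i0 _] := cut_level i; have /andP[_ i1] := cut_level i'.
apply: (quantile_lt hmu) => //.
by rewrite ltr_pM2r ?invr_gt0// ltr_nat.
Qed.

(** For increasing cuts the bound of index [j] implies all later ones; at [j = l] no bound is
    left. *)
Lemma mass_lower_cuts l u (j : nat) : u != 0 -> (j <= l)%N ->
  mass (lower_regions u (cuts l u) j) = j.+1%:R / l.+1%:R * mass setT.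
Proof.
move=> u0; rewrite leq_eqVlt => /orP[/eqP ->|jl].
  by rewrite lower_regions_all divff// mul1r.
rewrite -(quantileP hmu u0 (cut_level (Ordinal jl))); congr mass.
apply/seteqP; split => x; first by apply.
move=> h i ji; apply: le_trans h _; rewrite -/(cuts l u (Ordinal jl)).
move: ji; rewrite leq_eqVlt => /orP[/eqP ji|ji]; last by apply/ltW/cuts_lt.
by rewrite (_ : Ordinal jl = i)//; exact: val_inj.
Qed.

Lemma mass_region l u (j : 'I_l.+1) : u != 0 ->
  mass (region u (cuts l u) j) = l.+1%:R^-1 * mass setT.
Proof.
move=> u0; case: (unliftP ord0 j) => [i ->|->]; last first.
  by rewrite -lower_regions0 mass_lower_cuts// mul1r.
have := mass_lower_regionsS i u0 measurableT (cuts_lt u0).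
rewrite !setTI !mass_lower_cuts// => [e|]; last exact: ltnW.
apply/eqP; rewrite -subr_eq0; apply/eqP; move: e.
rewrite -[i.+2%:R]natr1 mulrDl mulrDl mul1r => /addrI <-.
by rewrite subrr.
Qed.

Lemma cutsN l u (i : 'I_l) : u != 0 -> cuts l (- u) i = - cuts l u (rev_ord i).
Proof.
move=> u0; rewrite /cuts quantileN ?cut_level//; congr (- quantile _ _ _).
have il := ltn_ord i; rewrite /= -{1}(@divff _ l.+1%:R) ?pnatr_eq0// -mulrBl -natrB.
  by congr (_%:R / _); lia.
exact: ltnW.
Qed.

(** Reversing the normal exchanges the quantile levels p and 1 - p, hence reverses the order of the
    cuts. *)
Lemma region_cutsN l u (j : 'I_l.+1) : u != 0 ->
  region (- u) (cuts l (- u)) j = region u (cuts l u) (rev_ord j).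
Proof.
move=> u0; have jl := ltn_ord j.
have E x (i : 'I_l) :
    (if (i < j)%N then cuts l (- u) i <= dotRV (- u) x
     else dotRV (- u) x <= cuts l (- u) i) =
    (if (rev_ord i < rev_ord j)%N then cuts l u (rev_ord i) <= dotRV u x
     else dotRV u x <= cuts l u (rev_ord i)).
  rewrite cutsN// dotRVN !lerN2 /=; have il := ltn_ord i.
  by case: ifP; case: ifP => //; lia.
apply/seteqP; split => x h i; last by rewrite E; exact: h.
by have := h (rev_ord i); rewrite E !rev_ordK.
Qed.

Definition median u : R := quantile mu 2^-1 u.

Lemma half_level : 0 < (2^-1 : R) < 1.
Proof. by apply/andP; split; lra. Qed.

Lemma medianN u : u != 0 -> median (- u) = - median u.
Proof.
move=> u0; rewrite /median quantileN ?half_level//; congr (- quantile _ _ _); lra.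
Qed.

Lemma mass_halfspace_median s u : u != 0 ->
  mass (halfspace s u (median u)) = 2^-1 * mass setT.
Proof.
move=> u0; have lo : mass (halfspace false u (median u)) = 2^-1 * mass setT.
  by rewrite -[RHS](quantileP hmu u0 half_level).
case: s => //; have := mass_halfspaces (median u) u0 measurableT.
by rewrite !setTI lo; lra.
Qed.

(* If [v = t u], then one of the four wedges cut out by the two hyperplanes lies
   in a hyperplane. *)
Lemma not_parallel u v (c e : R) : u != 0 -> v != 0 ->
  (forall s t, 0 < mass (halfspace s u c `&` halfspace t v e)) ->
  ~ parallel_normals u v.
Proof.
move=> u0 v0 pos [t vE].
have pt s s' : exists x, [/\ halfspace s u c x, halfspace s' v e x & dotRV u x != c].
  apply: contrapT => nx; have := pos s s'; rewrite ltNge => /negP; apply.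
  rewrite -(mass_hyperplane hmu c u0); apply: mass_le.
  - by apply: measurableI; exact: measurable_halfspace.
  - exact: measurable_hyperplane.
  - move=> x [h1 h2]; apply/eqP/negPn/negP => h3; apply: nx; by exists x.
have dotE x : dotRV v x = t * dotRV u x.
  by rewrite vE /dotRV mulr_sumr; apply: eq_bigr => i _; rewrite mxE mulrA.
have t0 : t != 0 by apply: contra v0 => /eqP t0; rewrite vE t0 scale0r.
have lo s' : exists2 x, dotRV u x < c & halfspace s' v e x.
  have [x [h1 h2 h3]] := pt false s'; exists x => //.
  by rewrite lt_neqAle h3.
have hi s' : exists2 x, c < dotRV u x & halfspace s' v e x.
  have [x [h1 h2 h3]] := pt true s'; exists x => //.
  by rewrite lt_neqAle eq_sym h3.
case: (ltgtP t 0) t0 => // ts _.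
  have [x x1 x2] := lo false; have [y y1 y2] := hi true.
  move: x2 y2; rewrite /halfspace /= !dotE; rewrite -(ltr_nM2l ts) in x1.
  by rewrite -(ltr_nM2l ts) in y1; lra.
have [x x1 x2] := lo true; have [y y1 y2] := hi false.
move: x2 y2; rewrite /halfspace /= !dotE; rewrite -(ltr_pM2l ts) in x1.
by rewrite -(ltr_pM2l ts) in y1; lra.
Qed.

End Regions.

Lemma row_flip (R : realType) d i j (x : 'M[R]_(3, d)) :
  row i (flip j x) = if i == j then - row i x else row i x.
Proof. by apply/matrixP => a b; rewrite !mxE; case: eqP; rewrite !mxE. Qed.

Lemma row_continuousD (R : realType) d (f g : 'M[R]_(3, d) -> R) :
  row_continuous f -> row_continuous g -> row_continuous (fun x => f x + g x).
Proof.
move=> cf cg x x0 e e0; have e20 : 0 < e / 2 by rewrite divr_gt0.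
have [a a0 fa] := cf x x0 _ e20; have [b b0 gb] := cg x x0 _ e20.
exists (Num.min a b); first by rewrite lt_min a0.
move=> y y0 yx; rewrite opprD addrACA [e]splitr (le_lt_trans (ler_normD _ _))// ltrD//.
  by apply: fa => // i l; have := yx i l; rewrite lt_min => /andP[].
by apply: gb => // i l; have := yx i l; rewrite lt_min => /andP[].
Qed.

Lemma row_continuousZ (R : realType) d (c : R) (f : 'M[R]_(3, d) -> R) :
  row_continuous f -> row_continuous (fun x => c * f x).
Proof.
move=> cf x x0 e e0; have c0 : 0 < `|c| + 1 by rewrite ltr_wpDl.
have [a a0 fa] := cf x x0 _ (divr_gt0 e0 c0).
exists a => // y y0 yx; rewrite -mulrBr normrM.
have := fa y y0 yx; rewrite ltr_pdivlMr// mulrC; apply: le_lt_trans.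
by rewrite ler_wpM2r// lerDl.
Qed.

(** * The boxes determined by three normals *)

Section Boxes.
Variables (R : realType) (d l : nat).
Variable mu : {finite_measure set (borelRV R d) -> \bar R}.
Hypothesis hmu : mass_distribution mu.
Implicit Types (x : 'M[R]_(3, d)).

Local Notation mass := (mass mu).
Local Notation cuts := (@cuts R d mu l).
Local Notation median := (@median R d mu).

Definition box x (j : 'I_l.+1) (s t : bool) : set (borelRV R d) :=
  region (row 0 x) (cuts (row 0 x)) j
  `&` halfspace s (row 1 x) (median (row 1 x))
  `&` halfspace t (row 2 x) (median (row 2 x)).

Lemma measurable_box x j s t : measurable (box x j s t).
Proof.
apply: measurableI; last exact: measurable_halfspace.
by apply: measurableI; [exact: measurable_region|exact: measurable_halfspace].
Qed.

Lemma box_flip0 x j s t : nonzero_rows x -> box (flip 0 x) j s t = box x (rev_ord j) s t.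
Proof. by move=> x0; rewrite /box !row_flip /= region_cutsN. Qed.

Lemma box_flip1 x j s t : nonzero_rows x -> box (flip 1 x) j s t = box x j (~~ s) t.
Proof. by move=> x0; rewrite /box !row_flip /= medianN// halfspaceN. Qed.

Lemma box_flip2 x j s t : nonzero_rows x -> box (flip 2 x) j s t = box x j s (~~ t).
Proof. by move=> x0; rewrite /box !row_flip /= medianN// halfspaceN. Qed.

(** Moving the normals slightly changes the box only inside the union of thin slabs around the
    bounding hyperplanes. *)
Lemma box_continuous j s t : row_continuous (fun x => mass (box x j s t)).
Proof.
move=> x x0 e e0.
(* The index [a] runs over the [l + 2] hyperplanes: the parallel cuts and the two halving ones. *)
pose dir (a : 'I_l + bool) : 'I_3 := match a with inl _ => 0 | inr b => if b then 1 else 2 end.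
pose level (a : 'I_l + bool) : R :=
  match a with inl i => i.+1%:R / l.+1%:R | inr _ => 2^-1 end.
have level01 a : 0 < level a < 1 by case: a => [i|b]; [exact: cut_level|exact: half_level].
pose q a y := quantile mu (level a) (row (dir a) y).
pose N := #|{: 'I_l + bool}|.
have eN : 0 < e / N.+1%:R by rewrite divr_gt0.
have /choice[r rP] : forall a, exists r,
    0 < r /\ mass (slab (row (dir a) x) (q a x) r) < e / N.+1%:R.
  by move=> a; have [r r0 rP] := slab_small hmu (q a x) (x0 (dir a)) eN; exists r.
pose S : set (borelRV R d) := \big[setU/set0]_a slab (row (dir a) x) (q a x) (r a).
have [mS Se] : measurable S /\ mass S < e.
  have : measurable S /\ mass S <= \sum_(a : 'I_l + bool) e / N.+1%:R.
    rewrite /S; elim/big_ind2: _ => [|A a B b [mA Aa] [mB Bb]|a _].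
    - by rewrite mass0.
    - split; first exact: measurableU.
      by rewrite (le_trans (massU_le _ mA mB))// lerD.
    - by split; [exact: measurable_slab|have [_ /ltW] := rP a].
  move=> [mS h]; split=> //; apply: le_lt_trans h _; rewrite sumr_const -[_ *+ #|_|]mulr_natr -/N.
  by rewrite -mulrA gtr_pMr// mulrC ltr_pdivrMr// mul1r ltr_nat.
have /choice[w wP] : forall a, exists w, 0 < w /\ forall y, nonzero_rows y ->
    (forall i m, `|y i m - x i m| < w) -> `|q a y - q a x| < r a.
  move=> a; have [r0 _] := rP a.
  have [w w0 wP] := quantile_near hmu (level01 a) (x0 (dir a)) r0.
  exists w; split=> // y y0 yx; apply: wP => [|i]; first exact: y0.
  by rewrite !mxE.
have [g g0 gP] : exists2 g, 0 < g & forall a, g <= Num.min (r a) (w a).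
  by apply: finite_radius => a; rewrite lt_min; have [-> _] := rP a; have [-> _] := wP a.
exists g => // y y0 yx; apply: le_lt_trans Se.
apply: mass_dist => //; try exact: measurable_box.
move=> z nSz.
have side a : (dotRV (row (dir a) y) z <= q a y <-> dotRV (row (dir a) x) z <= q a x) /\
    (q a y <= dotRV (row (dir a) y) z <-> q a x <= dotRV (row (dir a) x) z).
  have := gP a; rewrite le_min => /andP[gr gw].
  apply: (slab_side (e := r a)).
  - by move=> i; rewrite !mxE; apply: lt_le_trans gr.
  - by apply: (wP a).2 => // i m; apply: lt_le_trans gw.
  - by move=> h; apply: nSz; rewrite /S (bigD1 a)//=; left.
have hs a b : halfspace b (row (dir a) y) (q a y) z <-> halfspace b (row (dir a) x) (q a x) z.
  by rewrite /halfspace /=; case: b; have [? ?] := side a.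
have := hs (inr true) s; have := hs (inr false) t; rewrite /q /= -/(median _) => h2 h1.
have h0 : region (row 0 y) (cuts (row 0 y)) j z <-> region (row 0 x) (cuts (row 0 x)) j z.
  split => h i; have := h i; have := hs (inl i) (i < j)%N;
    by rewrite /halfspace /q /=; case: ifP => _ [].
by rewrite /box; split => -[[? ?] ?]; split; [split| |split|]; tauto.
Qed.

(** The Fourier coefficients, over the group (Z/2)^2, of the four masses in region [j]. *)
Definition signed x (j : 'I_l.+1) (b c : bool) : R :=
  \sum_(s : bool) \sum_(t : bool) (-1) ^+ (b && s) * (-1) ^+ (c && t) * mass (box x j s t).

Lemma signed_continuous j b c : row_continuous (fun x => signed x j b c).
Proof.
have -> : (fun x => signed x j b c) = (fun x =>
    ((-1) ^+ b * (-1) ^+ c * mass (box x j true true) + (-1) ^+ b * mass (box x j true false)) +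
    ((-1) ^+ c * mass (box x j false true) + 1 * mass (box x j false false))).
  apply/funext => x; rewrite /signed !big_bool /= !andbT !andbF expr0; ring.
by do 3?apply: row_continuousD; apply: row_continuousZ; exact: box_continuous.
Qed.

Lemma signed_flip1 x j b c : nonzero_rows x -> signed (flip 1 x) j b c = (-1) ^+ b * signed x j b c.
Proof.
move=> x0; rewrite /signed !big_bool !box_flip1//=.
by case: b; case: c; rewrite /= ?expr0 ?expr1; ring.
Qed.

Lemma signed_flip2 x j b c : nonzero_rows x -> signed (flip 2 x) j b c = (-1) ^+ c * signed x j b c.
Proof.
move=> x0; rewrite /signed !big_bool !box_flip2//=.
by case: b; case: c; rewrite /= ?expr0 ?expr1; ring.
Qed.

Lemma signed_flip0 x j b c : nonzero_rows x -> signed (flip 0 x) j b c = signed x (rev_ord j) b c.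
Proof. by move=> x0; rewrite /signed !big_bool !box_flip0. Qed.

Lemma signed_ff x j : nonzero_rows x -> signed x j false false = l.+1%:R^-1 * mass setT.
Proof.
move=> x0; rewrite -(mass_region hmu j (x0 0)).
have mR := @measurable_region R d l (row 0 x) (cuts (row 0 x)) j.
pose A s : set (borelRV R d) := region (row 0 x) (cuts (row 0 x)) j
  `&` halfspace s (row 1 x) (median (row 1 x)).
have mA s : measurable (A s) by apply: measurableI => //; exact: measurable_halfspace.
rewrite (mass_halfspaces hmu (median (row 1 x)) (x0 1) mR) -!/(A _).
rewrite (mass_halfspaces hmu (median (row 2 x)) (x0 2) (mA false)).
rewrite (mass_halfspaces hmu (median (row 2 x)) (x0 2) (mA true)).
by rewrite /signed !big_bool /= !expr0 /box -!/(A _); ring.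
Qed.

(** Summed over the regions, this is the difference of the masses of two complementary half-spaces
    bounded by a median hyperplane. The relation saves one test function. *)
Lemma sum_signed_tf x : nonzero_rows x -> \sum_j signed x j true false = 0.
Proof.
move=> x0; pose H s : set (borelRV R d) := halfspace s (row 1 x) (median (row 1 x)).
pose A j s : set (borelRV R d) := H s `&` region (row 0 x) (cuts (row 0 x)) j.
have mH s : measurable (H s) by exact: measurable_halfspace.
have mA j s : measurable (A j s) by apply: measurableI => //; exact: measurable_region.
have sE j : signed x j true false = mass (A j false) - mass (A j true).
  rewrite (mass_halfspaces hmu (median (row 2 x)) (x0 2) (mA j false)).
  rewrite (mass_halfspaces hmu (median (row 2 x)) (x0 2) (mA j true)).
  rewrite /signed !big_bool /= expr0 expr1.
  have bE s t : box x j s t = A j s `&` halfspace t (row 2 x) (median (row 2 x)).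
    by rewrite /box /A [H s `&` _]setIC.
  by rewrite !bE; ring.
rewrite (eq_bigr _ (fun j _ => sE j)) sumrB !sum_mass_regions//; try exact: cuts_lt.
by rewrite !mass_halfspace_median// subrr.
Qed.

Lemma sum_signed_ft x : nonzero_rows x -> \sum_j signed x j false true = 0.
Proof.
move=> x0; pose H t : set (borelRV R d) := halfspace t (row 2 x) (median (row 2 x)).
pose A j t : set (borelRV R d) := H t `&` region (row 0 x) (cuts (row 0 x)) j.
have mH t : measurable (H t) by exact: measurable_halfspace.
have mA j t : measurable (A j t) by apply: measurableI => //; exact: measurable_region.
have sE j : signed x j false true = mass (A j false) - mass (A j true).
  rewrite (mass_halfspaces hmu (median (row 1 x)) (x0 1) (mA j false)).
  rewrite (mass_halfspaces hmu (median (row 1 x)) (x0 1) (mA j true)).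
  rewrite /signed !big_bool /= expr0 expr1.
  have bE s t : box x j s t = A j t `&` halfspace s (row 1 x) (median (row 1 x)).
    by rewrite /box /A setIAC [H t `&` _]setIC.
  by rewrite !bE; ring.
rewrite (eq_bigr _ (fun j _ => sE j)) sumrB !sum_mass_regions//; try exact: cuts_lt.
by rewrite !mass_halfspace_median// subrr.
Qed.

(** Fourier inversion: only the trivial coefficient, the mass of a region, survives, so each box has
    a quarter of it. *)
Lemma box_mass x : nonzero_rows x ->
  (forall j b c, b || c -> signed x j b c = 0) ->
  forall j s t, mass (box x j s t) = (4 * l.+1)%:R^-1 * mass setT.
Proof.
move=> x0 z j s t; rewrite natrM invfM -mulrA -(signed_ff j x0).
have := z j true false isT; have := z j false true isT; have := z j true true isT.
by rewrite /signed !big_bool /= !expr0 !expr1; case: s; case: t; lra.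
Qed.

(** Every wedge of two of the hyperplanes contains a box, which has positive mass, so [not_parallel]
    applies. *)
Lemma box_equipartition x : nonzero_rows x -> (0 < l)%N ->
  (forall j b c, b || c -> signed x j b c = 0) ->
  [/\ ~ parallel_normals (row 0 x) (row 1 x), ~ parallel_normals (row 0 x) (row 2 x)
    & ~ parallel_normals (row 1 x) (row 2 x)] /\
  equipartition mu (row 0 x) (cuts (row 0 x)) (row 1 x) (median (row 1 x))
    (row 2 x) (median (row 2 x)).
Proof.
move=> x0 l0 z; have mb := box_mass x0 z.
have pos j s t : 0 < mass (box x j s t).
  by rewrite mb mulr_gt0// ?massT_gt0// invr_gt0 ltr0n muln_gt0.
split; last first.
  move=> j s t; rewrite (massE mu measurableT) -EFinM -(mb j s t) -massE//.
  exact: measurable_box.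
have sub (A : set (borelRV R d)) j s t : measurable A -> box x j s t `<=` A -> 0 < mass A.
  move=> mA bA; apply: lt_le_trans (pos j s t) _; apply: mass_le => //.
  exact: measurable_box.
(* The parallel family is represented by its first cut, with the first region on one side and the
   last region on the other. *)
pose i0 := Ordinal l0; pose J (b : bool) : 'I_l.+1 := if b then ord_max else ord0.
have J0 b : region (row 0 x) (cuts (row 0 x)) (J b) `<=` halfspace b (row 0 x) (cuts (row 0 x) i0).
  by move=> y /(_ i0); rewrite /J /halfspace; case: b; rewrite /= ?l0.
have mI s u c t v e : measurable (halfspace s u c `&` halfspace t v e : set (borelRV R d)).
  by apply: measurableI; exact: measurable_halfspace.
split.
- apply: (not_parallel hmu (c := cuts (row 0 x) i0) (e := median (row 1 x))) => // s t.
  apply: (sub _ (J s) t true (mI _ _ _ _ _ _)).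
  by move=> y [[h1 h2] _]; split => //; exact: J0 h1.
- apply: (not_parallel hmu (c := cuts (row 0 x) i0) (e := median (row 2 x))) => // s t.
  apply: (sub _ (J s) true t (mI _ _ _ _ _ _)).
  by move=> y [[h1 _] h2]; split => //; exact: J0 h1.
- apply: (not_parallel hmu (c := median (row 1 x)) (e := median (row 2 x))) => // s t.
  by apply: (sub _ ord0 s t (mI _ _ _ _ _ _)) => y [[_ h1] h2].
Qed.

End Boxes.

Lemma prod_powers (A : comNzRingType) (a b c d e f : A) k :
  a ^+ k * (b ^+ k * (c ^+ k.+1 * (d ^+ k.+1 * (e ^+ k.+1 * f ^+ k.+1)))) =
  (a * b) ^+ k * (c * d * e * f) ^+ k.+1.
Proof. by rewrite !exprMn !mulrA. Qed.

(** * The test functions and the product of their characters *)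

Section Labels.
Variable k : nat.

(* The label (a, (b, c), j) stands for T_j + (-1)^a T_(2k+1-j), where T_j is the
   sum over the four boxes in region j with signs given by b and c. *)
Definition label := (bool * (bool * bool) * nat)%type.

Definition label_char (l : label) (i : 'I_3) : bool :=
  nth false [:: l.1.1; l.1.2.1; l.1.2.2] i.

(** Regions j and 2k+1-j are paired, so j <= k suffices. For the characters x_2 and x_3 the index 0
    is left out, as [sum_signed_tf] and [sum_signed_ft] supply the missing condition; hence their
    exponent k instead of k + 1. *)
Definition labels : seq label :=
  [seq ((false, (true, false)), j) | j <- iota 1 k] ++
  [seq ((false, (false, true)), j) | j <- iota 1 k] ++
  [seq ((true, (true, false)), j) | j <- iota 0 k.+1] ++
  [seq ((true, (false, true)), j) | j <- iota 0 k.+1] ++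
  [seq ((false, (true, true)), j) | j <- iota 0 k.+1] ++
  [seq ((true, (true, true)), j) | j <- iota 0 k.+1].

Lemma prod_labels : \prod_(l <- labels) \sum_i ((label_char l i)%:R : 'F_2) *: xvar i =
  (xvar 1 * xvar 2) ^+ k *
    ((xvar 0 + xvar 1) * (xvar 0 + xvar 2) * (xvar 1 + xvar 2) *
     (xvar 0 + xvar 1 + xvar 2)) ^+ k.+1.
Proof.
have pr a b c (s : seq nat) :
    \prod_(l <- [seq ((a, (b, c)), j) | j <- s]) \sum_i ((label_char l i)%:R : 'F_2) *: xvar i =
    ((a%:R : 'F_2) *: xvar 0 + (b%:R : 'F_2) *: xvar 1 + (c%:R : 'F_2) *: xvar 2) ^+ size s.
  elim: s => [|j s IH]; first by rewrite big_nil expr0.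
  rewrite /= big_cons IH exprS; congr (_ * _).
  rewrite !big_ord_recl big_ord0 addr0 addrA /label_char /=.
  by congr (_ *: xvar _ + _ *: xvar _ + _ *: xvar _); exact: val_inj.
rewrite /labels !big_cat !pr !size_iota /=.
move: (xvar 0) (xvar 1) (xvar 2) => x y z; rewrite !scale0r !scale1r !add0r !addr0.
exact: (@prod_powers F2poly3).
Qed.

Lemma mem_labels a b c j : (j <= k)%N -> b || c ->
  (j != 0)%N || a || (b && c) -> ((a, (b, c)), j) \in labels.
Proof.
move=> jk bc h; rewrite /labels !mem_cat.
have mp (c0 c1 : bool * (bool * bool)) m n :
    (((c0, j) : label) \in [seq (c1, j) | j <- iota m n]) = (c0 == c1) && (j \in iota m n).
  apply/mapP/andP => [[j' jn [-> ->]]//|[/eqP -> jn]]; by exists j.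
by rewrite !mp !mem_iota; case: a b c bc h => [] [] [] //=; lia.
Qed.

End Labels.

Theorem theorem4p4 (R : realType) (d k : nat) (hd : (1 <= d)%N)
    (Q : F2poly3) (hQ : obstruction_poly k Q)
    (hI : ~ in_ideal_of [:: xvar 0 ^+ d; xvar 1 ^+ d; xvar 2 ^+ d] Q)
    (mu : {finite_measure set (borelRV R d) -> \bar R})
    (hmu : mass_distribution mu) :
  exists (u : 'rV[R]_d) (c : 'I_(2 * k + 1) -> R)
         (v : 'rV[R]_d) (b : R) (w : 'rV[R]_d) (e : R),
    [/\ u != 0, v != 0 & w != 0] /\
    (forall i j : 'I_(2 * k + 1), (i < j)%N -> c i < c j) /\
    [/\ ~ parallel_normals u v, ~ parallel_normals u w
      & ~ parallel_normals v w] /\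
    equipartition mu u c v b w e.
Proof.
pose l := (2 * k + 1)%N.
have [m mQ md] : exists2 m, m \in msupp Q & forall j : 'I_3, (m j < d)%N.
  apply: contrapT => nm; apply: hI; apply: in_ideal_monomials => m mQ.
  apply: contrapT => nj; apply: nm; exists m => // j; rewrite ltnNge; apply/negP => dj.
  by apply: nj; exists j.
pose f (a : label) (x : 'M[R]_(3, d)) : R :=
  let j : 'I_l.+1 := inord a.2 in
  signed mu x j a.1.2.1 a.1.2.2 + (-1) ^+ a.1.1 * signed mu x (rev_ord j) a.1.2.1 a.1.2.2.
have f_flip a j x : nonzero_rows x -> f a (flip j x) = (-1) ^+ label_char a j * f a x.
  case: a => -[a [b c]] n x0; rewrite /f /label_char /=.
  case: j => -[|[|[|//]]] j3 /=.
  - rewrite (_ : Ordinal j3 = 0); last exact: val_inj.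
    by rewrite !signed_flip0// rev_ordK mulrDr mulrA -expr2 sqrr_sign mul1r addrC.
  - rewrite (_ : Ordinal j3 = 1); last exact: val_inj.
    by rewrite !signed_flip1//; ring.
  - rewrite (_ : Ordinal j3 = 2); last exact: val_inj.
    by rewrite !signed_flip2//; ring.
have f_cont a : row_continuous (f a).
  by apply: row_continuousD; [|apply: row_continuousZ]; exact: signed_continuous.
have cf : coef (fun a i => (label_char a i)%:R : 'F_2) (labels k) (fun j => m j) != 0.
  by rewrite -mcoeff_prod_linear prod_labels -(obstruction_polyE hQ) -mcoeff_msupp.
have [x x0 fx] := equivariant_zero f_flip f_cont md cf.
(* Both the sum and the difference over a pair of opposite regions vanish. *)
have pair j b c : (j <= k)%N -> b || c -> (j != 0)%N || (b && c) ->
    signed mu x (inord j : 'I_l.+1) b c = 0 /\ signed mu x (rev_ord (inord j : 'I_l.+1)) b c = 0.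
  move=> jk bc h.
  have := fx _ (mem_labels (a := false) jk bc _); rewrite orbF h => /(_ isT).
  have := fx _ (mem_labels (a := true) jk bc _); rewrite orbT => /(_ isT).
  by rewrite /f /= expr0 expr1 => h1 h2; split; lra.
(* For the two end regions the difference alone is available for every nontrivial character. *)
have diff b c : b || c -> signed mu x (ord0 : 'I_l.+1) b c = signed mu x (ord_max : 'I_l.+1) b c.
  move=> bc; have := fx _ (@mem_labels k true b c 0 (leq0n k) bc isT).
  have -> : f ((true, (b, c)), 0%N) x =
      signed mu x (ord0 : 'I_l.+1) b c - signed mu x (ord_max : 'I_l.+1) b c.
    have -> : f ((true, (b, c)), 0%N) x = signed mu x (inord 0 : 'I_l.+1) b c
        - signed mu x (rev_ord (inord 0 : 'I_l.+1)) b c by rewrite /f /= expr1 mulN1r.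
    have -> : inord 0 = ord0 :> 'I_l.+1 by apply: val_inj; rewrite /= inordK.
    by have -> : rev_ord ord0 = ord_max :> 'I_l.+1 by apply: val_inj; rewrite /= subn1.
  by move/eqP; rewrite subr_eq0 => /eqP.
have inner (j : 'I_l.+1) b c : b || c -> (j != ord0) && (j != ord_max) || (b && c) ->
    signed mu x j b c = 0.
  move=> bc h; have jl := ltn_ord j; case: (leqP j k) => jk.
    have [] // := pair j b c jk bc _; last by rewrite inord_val.
    by case/orP: h => [/andP[j0 _]|->]; rewrite ?orbT//; rewrite -val_eqE /= in j0; rewrite j0.
  have rk : (rev_ord j <= k)%N by move: jk; rewrite /= /l; move: (nat_of_ord j) => n; lia.
  have [] // := pair (rev_ord j) b c rk bc _; last by rewrite inord_val rev_ordK.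
  case/orP: h => [/andP[_ jm]|->]; rewrite ?orbT//.
  by rewrite -val_eqE /= in jm; rewrite /= subSS subn_eq0 -ltnNge ltn_neqAle jm -ltnS jl.
(* Once the inner terms vanish, the two end values sum to zero; being equal by [diff], both are
   zero. *)
have ends b c : b || c -> \sum_(j : 'I_l.+1) signed mu x j b c = 0 ->
    forall j : 'I_l.+1, signed mu x j b c = 0.
  move=> bc; rewrite (bigD1 ord0)//= (bigD1 ord_max)//=; last by rewrite -val_eqE /= /l; lia.
  rewrite big1 ?addr0 => [s0|j /andP[j0 jm]]; last by apply: inner; rewrite ?j0 ?jm.
  have e := diff b c bc; move=> j; case: (eqVneq j ord0) => [->|j0]; first lra.
  by case: (eqVneq j ord_max) => [->|jm]; [lra|apply: inner; rewrite ?j0 ?jm].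
have zero (j : 'I_l.+1) b c : b || c -> signed mu x j b c = 0.
  move: b c => [] [] // _; first by apply: inner; rewrite // orbT.
  - by apply: ends => //; exact: sum_signed_tf.
  - by apply: ends => //; exact: sum_signed_ft.
have [|npar eq] := box_equipartition hmu x0 _ zero; first by rewrite /l addn1.
exists (row 0 x), (@cuts R d mu l (row 0 x)), (row 1 x), (median mu (row 1 x)),
  (row 2 x), (median mu (row 2 x)).
by split; [split; exact: x0|split; [exact: cuts_lt|split]].
Qed.
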